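(* Let $\alpha,\beta>-1$. The connection coefficients $c_{\ell,n}^{(\alpha,\beta)}$ between $(1-x)\tilde{P}_n^{(\alpha+2,\beta)}(x)$ and $\tilde{P}_{\ell}^{(\alpha,\beta)}(x)$, i.e. the numbers with $(1-x)\tilde{P}_n^{(\alpha+2,\beta)}(x)=\sum_{\ell\ge0} c_{\ell,n}^{(\alpha,\beta)}\tilde{P}_{\ell}^{(\alpha,\beta)}(x)$, are, for $\ell,n\ge0$, $$ c_{\ell,n}^{(\alpha,\beta)} = \begin{cases} (\alpha+1)\sqrt{\dfrac{(2\ell+\alpha+\beta+1)\Gamma(\ell+\alpha+\beta+1)\Gamma(\ell+\alpha+1)}{\Gamma(\ell+\beta+1)\Gamma(\ell+1)}\cdot\dfrac{(2n+\alpha+\beta+3)\Gamma(n+\beta+1)\Gamma(n+1)}{\Gamma(n+\alpha+\beta+3)\Gamma(n+\alpha+3)}}, & \ell \le n,\\[2ex] -\sqrt{\dfrac{(n+1)(n+\beta+1)}{(n+\alpha+2)(n+\alpha+\beta+2)}}, & \ell = n+1,\\[2ex] 0, & \text{otherwise.} \end{cases} $$ Furthermore, for every integer $N\ge0$, the matrix of connection coefficients $C^{(\alpha,\beta)}=(c_{\ell,n}^{(\alpha,\beta)})_{0\le\ell\le N+1,\,0\le n\le N}\in\mathbb{R}^{(N+2)\times(N+1)}$ may be represented via the product of $N+1$ Givens rotations: $$ C^{(\alpha,\beta)} = G_0^{(\alpha,\beta)}G_1^{(\alpha,\beta)}\cdots G_{N-1}^{(\alpha,\beta)}G_{N}^{(\alpha,\beta)}\,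 I_{(N+2)\times (N+1)}, $$ where the sines and cosines of the Givens rotations are $$ s_n^{(\alpha,\beta)} = \sqrt{\dfrac{(n+1)(n+\beta+1)}{(n+\alpha+2)(n+\alpha+\beta+2)}},\qquad c_n^{(\alpha,\beta)} = \sqrt{\dfrac{(\alpha+1)(2n+\alpha+\beta+3)}{(n+\alpha+2)(n+\alpha+\beta+2)}}. $$
   Context: $P_n^{(\alpha,\beta)}$ denotes the Jacobi polynomial, orthogonal with respect to $(1-x)^\alpha(1+x)^\beta\,dx$ on $[-1,1]$ with standard normalization, and $$\tilde P_n^{(\alpha,\beta)}(x)=\sqrt{\frac{(2n+\alpha+\beta+1)\Gamma(n+\alpha+\beta+1)\,n!}{2^{\alpha+\beta+1}\Gamma(n+\alpha+1)\Gamma(n+\beta+1)}}\,P_n^{(\alpha,\beta)}(x)$$ are the orthonormal Jacobi polynomials. When $\alpha+\beta=-1$ and an index equals $0$, the product $(\alpha+\beta+1)\Gamma(\alpha+\beta+1)$ is understood as $\Gamma(\alpha+\beta+2)$. Rows and columns are indexed from $0$. $G_n^{(\alpha,\beta)}$ is the $(N+2)\times(N+2)$ identity matrix except in the intersections of rows and columns $n$ and $n+1$, where it equals $\begin{pmatrix} c_n^{(\alpha,\beta)} & s_n^{(\alpha,\beta)}\\ -s_n^{(\alpha,\beta)} & c_n^{(\alpha,\beta)}\end{pmatrix}$ (single-index $c_n^{(\alpha,\beta)}$ is the cosine, not to be confused with the double-index connection coefficient). $I_{p\times q}$ is the rectangular $p\times q$ matrix with ones on the main diagonal and zeros elsewhere.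 *)

(* Defs.v *)
From HB Require Import structures.
From mathcomp Require Import all_boot all_order all_algebra.
From mathcomp Require Import all_classical all_reals all_analysis.

Set Implicit Arguments.
Unset Strict Implicit.
Unset Printing Implicit Defensive.

Import Order.TTheory GRing.Theory Num.Theory.
Local Open Scope classical_set_scope.
Local Open Scope ring_scope.

Definition euler_integral (R : realType) (x : R) : R :=
  \int[@lebesgue_measure R]_(t in `]0, +oo[) (t `^ (x - 1) * expR (- t)).

(* Continued to the nonpositive axis by the recurrence Gamma (x + 1) =
   x * Gamma x: [Num.truncn (1 - x)] is the least k with 0 < x + k (so k = 0
   when 0 < x).  The value at the poles 0, -1, -2, ... is 0 and carries no
   meaning. *)
Definition Gamma (R : realType) (x : R) : R :=
  let k := Num.truncn (1 - x) in
  euler_integral (x + k%:R) / \prod_(i < k) (x + i%:R).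

Definition jacobi_weight (R : realType) (alpha beta x : R) : R :=
  (1 - x) `^ alpha * (1 + x) `^ beta.

(* The last clause is the standard normalization
   P_n(1) = binom (n + alpha) n = (alpha + 1)_n / n!. *)
Definition is_jacobi (R : realType) (alpha beta : R) (P : nat -> {poly R}) :
    Prop :=
  [/\ forall n, size (P n) = n.+1,
      forall m n, m <> n ->
        \int[@lebesgue_measure R]_(x in `[-1, 1])
          ((P m).[x] * (P n).[x] * jacobi_weight alpha beta x) = 0 &
      forall n, (P n).[1] = (\prod_(k < n) (alpha + 1 + k%:R)) / n`!%:R].

(* For alpha, beta > -1 exactly one family satisfies [is_jacobi alpha beta];
   otherwise the value may be arbitrary. *)
Definition jacobi (R : realType) (alpha beta : R) : nat -> {poly R} :=
  xget (fun=> 0) [set P | is_jacobi alpha beta P].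

(* (2n + alpha + beta + 1) Gamma(n + alpha + beta + 1), with the removable
   singularity at n = 0, alpha + beta = -1 filled in. *)
Definition shifted_Gamma (R : realType) (alpha beta : R) (n : nat) : R :=
  if (n == 0%N) && (alpha + beta == -1) then Gamma (alpha + beta + 2)
  else (2 * n%:R + alpha + beta + 1) * Gamma (n%:R + alpha + beta + 1).

Definition orthonormal_jacobi (R : realType) (alpha beta : R) (n : nat) :
    {poly R} :=
  Num.sqrt (shifted_Gamma alpha beta n * n`!%:R /
            (2 `^ (alpha + beta + 1) * Gamma (n%:R + alpha + 1)
             * Gamma (n%:R + beta + 1)))
  *: jacobi alpha beta n.

(* p_n = \sum_(l >= 0) c_(l, n) q_l for all n, as an expansion in the space of
   polynomials: for each n only finitely many c_(l, n) are nonzero. *)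
Definition connection_coefficients (R : realType) (p q : nat -> {poly R})
    (c : nat -> nat -> R) : Prop :=
  forall n, exists M : nat,
    (forall l, (M <= l)%N -> c l n = 0) /\
    p n = \sum_(l < M) c l n *: q l.

Definition givens_sin (R : realType) (alpha beta : R) (n : nat) : R :=
  Num.sqrt ((n%:R + 1) * (n%:R + beta + 1) /
            ((n%:R + alpha + 2) * (n%:R + alpha + beta + 2))).

Definition givens_cos (R : realType) (alpha beta : R) (n : nat) : R :=
  Num.sqrt ((alpha + 1) * (2 * n%:R + alpha + beta + 3) /
            ((n%:R + alpha + 2) * (n%:R + alpha + beta + 2))).

Definition givens (R : realType) (alpha beta : R) (m n : nat) : 'M[R]_m :=
  \matrix_(i < m, j < m)
    if (i == n :> nat) && (j == n :> nat) then givens_cos alpha beta n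
    else if (i == n :> nat) && (j == n.+1 :> nat) then givens_sin alpha beta n
    else if (i == n.+1 :> nat) && (j == n :> nat) then
      - givens_sin alpha beta n
    else if (i == n.+1 :> nat) && (j == n.+1 :> nat) then
      givens_cos alpha beta n
    else (i == j)%:R.

(* Main.v *)
(* In the variable y = 1 - x the Jacobi polynomials P_n^(a,b) are explicit
   hypergeometric polynomials, and comparing coefficients gives
     (n+a+b+2) (1-x) P_n^(a+2,b) = 2(a+1) P_n^(a+1,b) - 2(n+1) P_(n+1)^(a,b),
   while a telescoping contiguity relation expands P_n^(a+1,b) over the
   P_l^(a,b), l <= n (the Christoffel-Darboux kernel at 1), with coefficients
   of rank one in (l, n).  This yields the connection coefficients, and their
   rank-one structure is exactly that of a product of Givens rotations.

   [jacobi] is only specified by orthogonality.  The explicit polynomials are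
   orthogonal since they are eigenvectors, for distinct eigenvalues, of the
   Sturm-Liouville operator, which is symmetric for the weight w because
   ((1-x^2) w)' = (b-a-(a+b+2)x) w; no norm needs to be computed.  Uniqueness
   follows from positivity of the weight.  About Gamma, only positivity and
   Gamma(x+1) = x Gamma(x) are used. *)
Require Import Defs.
From HB Require Import structures.
From mathcomp Require Import all_boot all_order all_algebra.
From mathcomp Require Import all_classical all_reals all_analysis.
From mathcomp Require Import measurable_realfun zify ring lra.

Set Implicit Arguments.
Unset Strict Implicit.
Unset Printing Implicit Defensive.

Import Order.TTheory GRing.Theory Num.Theory.
Import numFieldNormedType.Exports.
Local Open Scope classical_set_scope.
Local Open Scope ring_scope.

(** * Integrals singular at both ends of an interval *)

Section exhaustion.
Variables (R : realType) (a b : nat -> R) (D : set R).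
Notation mu := (@lebesgue_measure R).
Hypotheses (ab : forall n, a n < b n).
Hypotheses (anoninc : {homo a : m n / (m <= n)%N >-> n <= m}).
Hypotheses (bnondec : {homo b : m n / (m <= n)%N >-> m <= n}).
Hypotheses (openD : open D) (DE : D = \bigcup_n [set` `[a n, b n]]).

Lemma exhaustion_nondecreasing :
  nondecreasing_seq (fun n => [set` `[a n, b n]]).
Proof.
move=> m n mn; rewrite subsetEset; apply: subset_itv; rewrite bnd_simp.
  exact: anoninc.
exact: bnondec.
Qed.

Lemma exhaustion_sub n : [set` `[a n, b n]] `<=` D.
Proof. by rewrite DE => x xn; exists n. Qed.

Lemma integral_exhaustion_ge0 (f : R -> \bar R) :
  measurable_fun D f -> (forall x, D x -> 0 <= f x)%E ->
  (\int[mu]_(x in `[a n, b n]) f x @[n --> \oo] --> \int[mu]_(x in D) f x)%E.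
Proof.
move=> mf f0; rewrite [in X in _ --> X]DE.
apply: ge0_nondecreasing_set_cvg_integral => //=.
- exact: exhaustion_nondecreasing.
- move=> n; apply: measurable_funS mf; first exact: open_measurable.
  exact: exhaustion_sub.
- by move=> n x xn; apply/f0/(@exhaustion_sub n).
Qed.

(** Monotone convergence applies to the positive and negative parts separately; integrability makes
    both limits finite, so their difference is meaningful. *)
Lemma integral_exhaustion (f : R -> \bar R) :
  mu.-integrable D f ->
  (\int[mu]_(x in `[a n, b n]) f x @[n --> \oo] --> \int[mu]_(x in D) f x)%E.
Proof.
move=> intf; have mf := measurable_int mu intf.
have mD : measurable D by exact: open_measurable.
rewrite [in X in _ --> X]integralE.
under eq_fun do rewrite integralE.
apply: cvgeB.
- apply: fin_num_adde_defr; exact: integrable_pos_fin_num.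
- apply: integral_exhaustion_ge0 => //; exact: measurable_funepos.
- apply: integral_exhaustion_ge0 => //; exact: measurable_funeneg.
Qed.

Variables (f F : R -> R).
Hypotheses (cf : {in D, continuous f}).
Hypotheses (dF : forall x, D x -> is_derive x 1 F (f x)).

Lemma exhaustion_FTC n :
  (\int[mu]_(x in `[a n, b n]) (f x)%:E = (F (b n) - F (a n))%:E)%E.
Proof.
have sub : [set` `[a n, b n]] `<=` D := @exhaustion_sub n.
have cF x : D x -> {for x, continuous F}.
  move=> /dF dFx; apply/differentiable_continuous/derivable1_diffP.
  exact: ex_derive.
have Dan : D (a n) by apply: sub; rewrite /= in_itv/= lexx ltW.
have Dbn : D (b n) by apply: sub; rewrite /= in_itv/= lexx ltW.
rewrite (@continuous_FTC2 _ f F) ?EFinB//.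
- apply: continuous_in_subspaceT => x; rewrite inE => /sub xD.
  by apply: cf; rewrite inE.
- split.
  + move=> x xab; have /sub/dF dFx : `[a n, b n]%classic x.
      exact: subset_itv_oo_cc xab.
    exact: ex_derive.
  + exact/cvg_at_right_filter/cF.
  + exact/cvg_at_left_filter/cF.
- move=> x xab; have /sub/dF dFx : `[a n, b n]%classic x.
    exact: subset_itv_oo_cc xab.
  by rewrite derive1E derive_val.
Qed.

(** For nonnegative [f] the integrals over the compact intervals increase to the integral over [D],
    and the fundamental theorem keeps each of them below [M]. *)
Lemma integrable_antiderivative_ge0 (M : R) : (forall x, D x -> 0 <= f x) ->
  (forall n, F (b n) - F (a n) <= M) -> mu.-integrable D (EFin \o f).
Proof.
move=> f0 FM.
have mf : measurable_fun D (EFin \o f).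
  by apply/measurable_EFinP; exact: open_continuous_measurable_fun.
apply/integrableP; split => //.
rewrite (@eq_integral _ _ _ mu D (EFin \o f)); last first.
  by move=> x /[!inE] Dx /=; rewrite ger0_norm// f0.
have cvgI := integral_exhaustion_ge0 mf (fun x Dx => f0 x Dx).
apply: (@le_lt_trans _ _ M%:E); last exact: ltry.
rewrite -(cvg_lim _ cvgI)//; apply: lime_le.
  by apply/cvg_ex; eexists; exact: cvgI.
by apply: nearW => n; rewrite exhaustion_FTC lee_fin.
Qed.

(** The improper form of the fundamental theorem. Integrability is assumed separately, since
    convergence of the increments of [F] alone does not give it. *)
Lemma Rintegral_antiderivative (l : R) : mu.-integrable D (EFin \o f) ->
  F (b n) - F (a n) @[n --> \oo] --> l -> \int[mu]_(x in D) f x = l.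
Proof.
move=> /[swap] Fl /integral_exhaustion.
rewrite (_ : (fun n => _) = EFin \o (fun n => F (b n) - F (a n))); last first.
  by apply/funext => n; exact: exhaustion_FTC.
rewrite /Rintegral => /cvg_lim <- //.
suff -> : limn (EFin \o (fun n => F (b n) - F (a n))) = l%:E by [].
apply/cvg_lim => //.
by apply: cvg_EFin => //; exact: nearW.
Qed.

End exhaustion.

(** * Vanishing and positivity of integrals of nonnegative functions *)

Section nonneg_integral.
Variables (R : realType) (D : set R) (f : R -> R).
Notation mu := (@lebesgue_measure R).

Lemma Rintegral_eq0_support : measurable D -> mu.-integrable D (EFin \o f) ->
  (forall x, D x -> 0 <= f x) -> \int[mu]_(x in D) f x = 0 ->
  mu (D `&` [set x | f x != 0]) = 0%E.
Proof.
move=> mD intf f0 If0.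
have mf := measurable_int mu intf.
have : (\int[mu]_(x in D) `|(f x)%:E| = 0)%E.
  rewrite (@eq_integral _ _ _ mu D (EFin \o f)); last first.
    by move=> x /[!inE] Dx /=; rewrite ger0_norm// f0.
  rewrite -[LHS]fineK; last exact: integrable_fin_num.
  by move: If0; rewrite /Rintegral => ->.
move/(ae_eq_integral_abs mu mD mf) => aef.
apply/negligibleP.
  rewrite [X in _.-measurable X](_ : _ = D `&` (EFin \o f) @^-1` [set~ 0%E]).
    by apply: mf => //; exact: measurableC.
  apply/seteqP; split=> x /= [Dx fx]; split => //.
    by move=> [/eqP]; rewrite (negbTE fx).
  by apply/eqP => fx0; apply: fx; rewrite fx0.
apply: negligibleS aef => x /= [Dx fx0] /(_ Dx) /= [] /eqP.
by rewrite (negbTE fx0).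
Qed.

Lemma Rintegral_gt0 : measurable D -> mu D != 0%E ->
  mu.-integrable D (EFin \o f) -> (forall x, D x -> 0 < f x) ->
  0 < \int[mu]_(x in D) f x.
Proof.
move=> mD D0 intf f0; rewrite lt_neqAle; apply/andP; split; last first.
  by apply: Rintegral_ge0 => x /f0 /ltW.
apply: contra D0 => /eqP/esym/Rintegral_eq0_support => <- //.
  by apply/eqP; congr (mu _); rewrite setIidl// => x /f0 /= /gt_eqF ->.
by move=> x /f0 /ltW.
Qed.

End nonneg_integral.

(** * The Gamma function *)

Section gamma.
Variable R : realType.
Notation mu := (@lebesgue_measure R).
Implicit Types x t : R.

(** For t >= 1, raise the exponent to an integer k >= x and keep one term (t/2)^k / k! of the
    exponential series; for t < 1 the power is at most 1, and the constant is at least 1. *)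
Lemma powR_le_expR x : 0 <= x ->
  exists2 C : R, 0 < C & forall t, 0 < t -> t `^ x <= C * expR (t / 2).
Proof.
move=> x0; pose k := (Num.truncn x).+1.
have xk : x <= k%:R by rewrite ltW// truncnS_gt.
have C1 : 1 <= 2 ^+ k * k`!%:R :> R.
  by rewrite mulr_ege1// ?exprn_ege1 ?ler1n// ?fact_gt0.
have C0 : 0 < 2 ^+ k * k`!%:R :> R by exact: lt_le_trans ltr01 C1.
exists (2 ^+ k * k`!%:R) => // t t0.
have et1 : 1 <= expR (t / 2) by rewrite -expR0 ler_expR divr_ge0// ltW.
have [t1|t1] := leP 1 t.
  apply: (@le_trans _ _ (t `^ k%:R)); first by rewrite ler_powR.
  rewrite powR_mulrn ?(ltW t0)//.
  have := @expR_ge1Dxn R (t / 2) k.-1 (divr_ge0 (ltW t0) (ler0n _ _)).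
  rewrite prednK// => h.
  have -> : t ^+ k = 2 ^+ k * k`!%:R * ((t / 2) ^+ k / k`!%:R).
    rewrite exprMn exprVn; field.
    by rewrite pnatr_eq0 -lt0n fact_gt0 expf_neq0.
  by rewrite ler_wpM2l ?(ltW C0)// (le_trans _ h)// lerDr.
apply: (@le_trans _ _ 1); last by rewrite mulr_ege1.
by rewrite -[leRHS](congr1 (fun g => g x) (powR1 R)) ge0_ler_powR// ?nnegrE
  ?ltW.
Qed.

(** The offset 2 keeps the values strictly below 1, so that both [s, 1/s] and [-1+s, 1-s] are
    nondegenerate intervals for every n. *)
Definition tail_inv (n : nat) : R := n.+2%:R^-1.

Lemma tail_inv_gt0 n : 0 < tail_inv n. Proof. by rewrite invr_gt0. Qed.

Lemma tail_inv_le m n : (m <= n)%N -> tail_inv n <= tail_inv m.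
Proof. by move=> mn; rewrite lef_pV2 ?posrE// ler_nat. Qed.

Lemma tail_inv_lt1 n : tail_inv n < 1.
Proof. by rewrite invf_lt1// ltr1n. Qed.

Lemma cvg_tail_inv : tail_inv n @[n --> \oo] --> 0.
Proof. by have := @cvg_harmonic R; rewrite -cvg_shiftS. Qed.

Lemma cvg_tail_inv_right : tail_inv n @[n --> \oo] --> 0^'+.
Proof.
move=> A /= nA; have : \forall n \near \oo, 0 < tail_inv n -> A (tail_inv n) :=
  cvg_tail_inv nA.
by apply: filterS => n; apply; exact: tail_inv_gt0.
Qed.

Lemma tail_inv_small x : 0 < x -> exists n, tail_inv n <= x.
Proof.
move=> x0; exists (Num.truncn x^-1);
  rewrite -[leRHS]invrK lef_pV2 ?posrE ?invr_gt0//.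
rewrite (le_trans (ltW (truncnS_gt _)))// ler_nat//.
Qed.


Lemma itv0y_exhaustion :
  `]0, +oo[%classic = \bigcup_n [set` `[tail_inv n, (tail_inv n)^-1]].
Proof.
apply/seteqP; split=> [x /=|x [n _] /=]; rewrite !in_itv/= ?andbT; last first.
  by move=> /andP[+ _]; exact: lt_le_trans (tail_inv_gt0 n).
move=> x0; have [m mx] := tail_inv_small x0.
have [n nx] : exists n, tail_inv n <= x^-1 by apply: tail_inv_small;
  rewrite invr_gt0.
exists (maxn m n) => //=; rewrite in_itv/=; apply/andP; split.
  by apply: le_trans mx; rewrite tail_inv_le// leq_maxl.
rewrite -[x]invrK lef_pV2 ?posrE ?invr_gt0 ?tail_inv_gt0//.
by apply: le_trans nx; rewrite tail_inv_le// leq_maxr.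
Qed.

Lemma powR_tail_inv_cvg0 x : 0 < x -> tail_inv n `^ x @[n --> \oo] --> 0.
Proof. by move=> x0; apply: cvg_comp cvg_tail_inv_right (powR_cvg0 x0). Qed.

Definition gamma_integrand x t : R := t `^ (x - 1) * expR (- t).

Lemma derive_expRM c t :
  is_derive t 1 (fun t : R => expR (c * t)) (c * expR (c * t)).
Proof.
have h : is_derive t 1 (fun t : R => c * t) c.
  by apply: (is_derive_eq (is_deriveZ c (is_derive_id t 1)));
    rewrite /GRing.scale/= mulr1.
by have := @is_derive1_comp R expR (fun t : R => c * t) t _ _ (is_derive_expR _)
  h; rewrite mulrC.
Qed.

Lemma derive_expRN t : is_derive t 1 (fun t : R => expR (- t)) (- expR (- t)).
Proof.
have := derive_expRM (- 1) t; rewrite mulN1r.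
by under eq_fun do rewrite mulN1r; rewrite mulN1r.
Qed.

(** This one derivative serves three times: for the continuity of the integrand, for its
    integrability, and for the functional equation of Gamma. *)
Lemma derive_gamma x t : 0 < t ->
  is_derive t 1 (gamma_integrand (x + 1))
    (x * gamma_integrand x t - gamma_integrand (x + 1) t).
Proof.
move=> t0; have h1 := is_derive1_powR x t0; have h2 := derive_expRN t.
have -> : gamma_integrand (x + 1) =
  (fun t : R => t `^ x) * (fun t : R => expR (- t)).
  by apply/funext => u; rewrite /gamma_integrand addrK.
apply: (is_derive_eq (is_deriveM h1 h2));
  rewrite /gamma_integrand !fctE /GRing.scale /=; ring.
Qed.

Lemma continuous_gamma_integrand x :
  {in `]0, +oo[%classic, continuous (gamma_integrand x)}.
Proof.
move=> t; rewrite inE/= in_itv/= andbT => t0.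
have := derive_gamma (x - 1) t0; rewrite subrK => -[dg _].
exact/differentiable_continuous/derivable1_diffP.
Qed.

Lemma gamma_integrand_gt0 x t : 0 < t -> 0 < gamma_integrand x t.
Proof. by move=> t0; rewrite mulr_gt0 ?powR_gt0 ?expR_gt0. Qed.

Lemma gamma_integrand_le x : 0 < x -> exists2 C : R, 0 < C &
  forall t, 0 < t -> gamma_integrand (x + 1) t <= C * expR (- 2^-1 * t).
Proof.
move=> x0; have [C C0 Cx] := powR_le_expR (ltW x0); exists C => // t t0.
rewrite /gamma_integrand addrK (_ : - 2^-1 * t = t / 2 + - t); last by field.
by rewrite expRD mulrA ler_pM2r ?expR_gt0// Cx.
Qed.

Lemma tail_inv_ltV n : tail_inv n < (tail_inv n)^-1.
Proof. by rewrite (lt_trans (tail_inv_lt1 n))// invf_gt1 ?tail_inv_gt0//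
  tail_inv_lt1. Qed.

Lemma tail_invV_le m n : (m <= n)%N -> (tail_inv m)^-1 <= (tail_inv n)^-1.
Proof. by move=> mn; rewrite lef_pV2 ?posrE ?tail_inv_gt0// tail_inv_le. Qed.

Lemma integrable_gamma x : 0 < x ->
  mu.-integrable `]0, +oo[ (EFin \o gamma_integrand x).
Proof.
move=> x0; have [C C0 Cx] := gamma_integrand_le x0.
(* [f] dominates [x * gamma_integrand x] and is the derivative of [F], which is
   bounded: the last term compensates for the negative part of the derivative
   of [gamma_integrand (x + 1)]. *)
pose f t := x * gamma_integrand x t - gamma_integrand (x + 1) t +
  C * expR (- 2^-1 * t).
pose F t := gamma_integrand (x + 1) t - 2 * C * expR (- 2^-1 * t).
have dF t : 0 < t -> is_derive t 1 F (f t).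
  move=> t0; have h1 := derive_gamma x t0; have h2 := derive_expRM (- 2^-1) t.
  apply: (is_derive_eq (is_deriveB h1 (is_deriveZ (2 * C) h2))).
  by rewrite /GRing.scale /= /f; field.
have cE t : {for t, continuous (fun t : R => expR (- 2^-1 * t))}.
  have [dh _] := derive_expRM (- 2^-1) t.
  exact/differentiable_continuous/derivable1_diffP.
have cg y : {in `]0, +oo[%classic, continuous (gamma_integrand y)}
  by exact: continuous_gamma_integrand.
have cf : {in `]0, +oo[%classic, continuous f}.
  move=> t t0; apply: cvgD; last by apply: cvgMl_tmp; exact: cE.
  by apply: cvgB; [apply: cvgMl_tmp|]; exact: cg.
have f0 t : t \in `]0, +oo[ -> x * gamma_integrand x t <= f t.
  rewrite in_itv/= andbT => t0.
  by rewrite /f -addrA lerDl addrC subr_ge0 Cx.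
have f0' t : t \in `]0, +oo[ -> 0 <= f t.
  move=> t0; apply: le_trans (f0 _ t0); rewrite mulr_ge0 ?(ltW x0)//.
  by move: t0; rewrite in_itv/= andbT => /gamma_integrand_gt0/ltW.
have intf : mu.-integrable `]0, +oo[ (EFin \o f).
  (* In the bound [C + 2 * C] on the increments of [F], the upper end contributes at most [C]; at
     the lower end only the exponential term counts, at most [2 * C]. *)
  apply: (@integrable_antiderivative_ge0 R tail_inv (fun n => (tail_inv n)^-1) _
    _ _ _ _ _ f F _ _ (C + 2 * C)) => //.
  - exact: tail_inv_ltV.
  - exact: tail_inv_le.
  - exact: tail_invV_le.
  - exact: itv0y_exhaustion.
  - by move=> t; rewrite /= in_itv/= andbT; exact: dF.
  - move=> n; have b0 : 0 < (tail_inv n)^-1 by rewrite invr_gt0 tail_inv_gt0.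
    rewrite /F.
    have h1 := Cx _ b0; have h2 := gamma_integrand_gt0 (x + 1) (tail_inv_gt0 n).
    have e1 (t : R) : 0 < t -> 0 < C * expR (- 2^-1 * t) <= C.
      move=> t0; rewrite mulr_gt0 ?expR_gt0//=
        -[leRHS]mulr1 ler_pM2l// -expR0 ler_expR.
      by rewrite mulNr oppr_le0 mulr_ge0// ltW.
    have := e1 _ b0; have := e1 _ (tail_inv_gt0 n) => /andP[? ?] /andP[? ?].
    lra.
apply: (@le_integrable _ _ _ mu `]0, +oo[%classic _ (EFin \o gamma_integrand x)
  (fun t => (x^-1)%:E * (EFin \o f) t)%E) => //.
- by apply/measurable_EFinP; exact: open_continuous_measurable_fun.
- move=> t t0; rewrite /=
    lee_fin !ger0_norm ?mulr_ge0 ?invr_ge0 ?(ltW x0) ?f0'//.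
    by rewrite mulrC ler_pdivlMr// mulrC f0.
  exact: powR_ge0.
- by have := integrableZl _ x^-1 intf; apply.
Qed.

Lemma euler_integral_gt0 x : 0 < x -> 0 < euler_integral x.
Proof.
move=> x0; apply: Rintegral_gt0 => //.
- by rewrite lebesgue_measure_itv/= ltry.
- exact: integrable_gamma.
- by move=> t; rewrite /= in_itv/= andbT; exact: gamma_integrand_gt0.
Qed.

(** Integration by parts: the two sides differ by the integral of the derivative of t^x e^(-t),
    which tends to 0 at both ends. *)
Lemma euler_integralS x : 0 < x ->
  euler_integral (x + 1) = x * euler_integral x.
Proof.
move=> x0; have [C C0 Cx] := gamma_integrand_le x0.
have x10 : 0 < x + 1 by rewrite ltr_wpDl ?ltW.
have i1 := integrable_gamma x0; have i2 := integrable_gamma x10.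
have i3 : mu.-integrable `]0, +oo[ (EFin \o (fun t => x * gamma_integrand x t)).
  by have := integrableZl _ x i1; apply.
apply/eqP; rewrite eq_sym -subr_eq0; apply/eqP.
rewrite -RintegralZl//= -RintegralB//.
apply: (@Rintegral_antiderivative R tail_inv (fun n => (tail_inv n)^-1) _ _ _ _
  _ _ _ (gamma_integrand (x + 1))).
- exact: tail_inv_ltV.
- exact: tail_inv_le.
- exact: tail_invV_le.
- exact: interval_open.
- exact: itv0y_exhaustion.
- move=> t t0; apply: cvgB; first apply: cvgMl_tmp;
    exact: continuous_gamma_integrand.
- by move=> t; rewrite /= in_itv/= andbT; exact: derive_gamma.
- by have := integrableB _ i3 i2; apply.
rewrite -[X in _ --> X](subr0 0); apply: cvgB.
  (* At infinity the bound C e^(-t/2) is weakened to 2C/t, using e^u >= u with u = t/2. *)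
  apply: (@squeeze_cvgr _ _ _ _ (cst 0) (fun n => 2 * C * tail_inv n)).
  - apply: nearW => n; have t0 : 0 < (tail_inv n)^-1
      by rewrite invr_gt0 tail_inv_gt0.
    rewrite (ltW (gamma_integrand_gt0 _ t0))/=.
    apply: le_trans (Cx _ t0) _;
      rewrite [2 * C]mulrC -mulrA ler_pM2l// mulNr expRN.
    rewrite -[leRHS]invrK lef_pV2 ?posrE ?expR_gt0 ?invr_gt0 ?mulr_gt0
      ?tail_inv_gt0//.
    by rewrite invfM; apply: le_trans (expR_ge1Dx _); rewrite lerDr.
  - exact: cvg_cst.
  - by rewrite -[X in _ --> X](mulr0 (2 * C)); apply: cvgMl_tmp;
      exact: cvg_tail_inv.
apply: (@squeeze_cvgr _ _ _ _ (cst 0) (fun n => tail_inv n `^ x)).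
- apply: nearW => n; have t0 := tail_inv_gt0 n.
  rewrite (ltW (gamma_integrand_gt0 _ t0))/= /gamma_integrand addrK.
  rewrite -[leRHS]mulr1 ler_pM2l ?powR_gt0// -expR0 ler_expR oppr_le0 ltW//.
- exact: cvg_cst.
- exact: powR_tail_inv_cvg0.
Qed.

Lemma Gamma_pos_euler x : 0 < x -> Gamma x = euler_integral x.
Proof.
move=> x0; rewrite /Gamma (_ : Num.truncn _ = 0%N) ?big_ord0 ?addr0 ?divr1//.
by apply/truncn0Pn; rewrite -ltNge; lra.
Qed.

Lemma Gamma_gt0 x : 0 < x -> 0 < Gamma x.
Proof. by move=> x0; rewrite Gamma_pos_euler ?euler_integral_gt0. Qed.

Lemma Gamma_neq0 x : 0 < x -> Gamma x != 0.
Proof. by move=> /Gamma_gt0/lt0r_neq0. Qed.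

Lemma GammaS x : 0 < x -> Gamma (x + 1) = x * Gamma x.
Proof.
by move=> x0; rewrite !Gamma_pos_euler ?euler_integralS//; lra.
Qed.

(** Three cases: a+b = -1 is the filled-in value; for a+b+1 > 0 it is the recurrence; for -1 < a+b+1
    < 0 the continuation in [Gamma] takes exactly one step and divides by a+b+1, which cancels. *)
Lemma shifted_Gamma0 (a b : R) : -1 < a -> -1 < b ->
  shifted_Gamma a b 0 = Gamma (a + b + 2).
Proof.
move=> a1 b1; rewrite /shifted_Gamma eqxx/=; case: eqP => // ab.
rewrite mulr0 !add0r; have [ab0|ab0] := ltP 0 (a + b + 1).
  by rewrite -GammaS//; congr Gamma; ring.
have h : Num.truncn (1 - (a + b + 1)) = 1%N.
  apply: truncn_def; apply/andP; split; first by lra.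
  by rewrite ltNge; apply/negP => ?; apply: ab; lra.
rewrite {1}/Gamma h big_ord1 addr0 mulrC divfK ?Gamma_pos_euler; last 2 first.
  lra.
  by apply/eqP => ?; apply: ab; lra.
by congr euler_integral; ring.
Qed.

End gamma.

(** * Integration against the Jacobi weight *)

Section jacobi_functional.
Variables (R : realType) (a b : R).
Hypotheses (a1 : -1 < a) (b1 : -1 < b).
Notation mu := (@lebesgue_measure R).
Notation w := (jacobi_weight a b).
Implicit Types (p q : {poly R}) (x t : R).

Let lo n : R := -1 + tail_inv R n.
Let hi n : R := 1 - tail_inv R n.

Let lohi n : lo n < hi n.
Proof.
rewrite /lo /hi; have := tail_inv_lt1 R n; lra.
Qed.

Let lo_noninc m n : (m <= n)%N -> lo n <= lo m.
Proof. by move=> mn; rewrite lerD2l tail_inv_le. Qed.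

Let hi_nondec m n : (m <= n)%N -> hi m <= hi n.
Proof. by move=> mn; rewrite lerD2l lerN2 tail_inv_le. Qed.

Let itv_exhaustion : `]-1, 1[%classic = \bigcup_n [set` `[lo n, hi n]].
Proof.
apply/seteqP; split=> [x /=|x [n _] /=]; rewrite !in_itv/=; last first.
  have := tail_inv_gt0 R n; rewrite /lo /hi => h /andP[h1 h2]; apply/andP; lra.
move=> /andP[x1 x2].
have [m mx] : exists n, tail_inv R n <= x + 1 by apply: tail_inv_small; lra.
have [n nx] : exists n, tail_inv R n <= 1 - x by apply: tail_inv_small; lra.
exists (maxn m n) => //=; rewrite in_itv/= /lo /hi.
have := tail_inv_le R (leq_maxl m n); have := tail_inv_le R (leq_maxr m n).
by move=> h1 h2; apply/andP; lra.
Qed.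

Lemma derive_1B_powR c x : x < 1 ->
  is_derive x 1 (fun t : R => (1 - t) `^ c) (- (c * (1 - x) `^ (c - 1))).
Proof.
move=> x1; have h1 : 0 < 1 - x by rewrite subr_gt0.
have h : is_derive x 1 (fun t : R => 1 - t) (-1).
  exact: is_derive_eq (is_deriveB (is_derive_cst (1 : R) x 1)
    (is_derive_id x 1)) (sub0r 1).
have := @is_derive1_comp R (fun t => t `^ c) (fun t => 1 - t) x _ _
  (is_derive1_powR c h1) h.
by rewrite mulrN1.
Qed.

Lemma derive_1D_powR c x : -1 < x ->
  is_derive x 1 (fun t : R => (1 + t) `^ c) (c * (1 + x) `^ (c - 1)).
Proof.
move=> x1; have h1 : 0 < 1 + x by lra.
have h : is_derive x 1 (fun t : R => 1 + t) 1.
  exact: is_derive_eq (is_deriveD (is_derive_cst (1 : R) x 1)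
    (is_derive_id x 1)) (add0r 1).
have := @is_derive1_comp R (fun t => t `^ c) (fun t => 1 + t) x _ _
  (is_derive1_powR c h1) h.
by rewrite mulr1.
Qed.

Let cD : {in `]-1, 1[%classic, continuous (fun t : R => (1 + t) `^ b)}.
Proof.
move=> x; rewrite inE/= in_itv/= => /andP[x1 x2].
have [dh _] := derive_1D_powR b x1.
exact/differentiable_continuous/derivable1_diffP.
Qed.

Let cB : {in `]-1, 1[%classic, continuous (fun t : R => (1 - t) `^ a)}.
Proof.
move=> x; rewrite inE/= in_itv/= => /andP[x1 x2].
have [dh _] := derive_1B_powR a x2.
exact/differentiable_continuous/derivable1_diffP.
Qed.

Lemma jacobi_weight_gt0 x : x \in `]-1, 1[ -> 0 < w x.
Proof. by rewrite in_itv/= => /andP[x1 x2]; rewrite mulr_gt0// powR_gt0;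
  lra. Qed.

Lemma measurable_jacobi_weight : measurable_fun setT w.
Proof.
apply: measurable_funM.
  have h : measurable_fun setT (fun x : R => 1 - x) by exact: measurable_funB.
  exact: (measurableT_comp (measurable_powR a) h).
have h : measurable_fun setT (fun x : R => 1 + x) by exact: measurable_funD.
exact: (measurableT_comp (measurable_powR b) h).
Qed.

Let powR_12_le (c t : R) : 1 <= t <= 2 -> t `^ c <= 2 `^ `|c|.
Proof.
move=> /andP[t1 t2]; apply: (@le_trans _ _ (t `^ `|c|)).
  by rewrite ler_powR// ler_norm.
by rewrite ge0_ler_powR ?nnegrE//; lra.
Qed.

Let powR_2_le (c t : R) : 0 <= c -> 0 <= t <= 2 -> t `^ c <= 2 `^ c.
Proof. by move=> c0 /andP[t0 t2]; rewrite ge0_ler_powR ?nnegrE//; lra. Qed.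

(** On each half of the interval one factor has its base in [1, 2] and is bounded, so the weight is
    at most a constant times (1-x)^a + (1+x)^b. That sum has an explicit antiderivative, bounded
    because a+1 and b+1 are positive. *)
Lemma integrable_jacobi_weight : mu.-integrable `]-1, 1[ (EFin \o w).
Proof.
have a10 : 0 < a + 1 by move: a1; lra.
have b10 : 0 < b + 1 by move: b1; lra.
pose f x : R := (1 - x) `^ a + (1 + x) `^ b.
pose F x : R := (b + 1)^-1 * (1 + x) `^ (b + 1) -
  (a + 1)^-1 * (1 - x) `^ (a + 1).
have intf : mu.-integrable `]-1, 1[ (EFin \o f).
  apply: (@integrable_antiderivative_ge0 R lo hi _ _ _ _ _ _ f F _ _
    ((b + 1)^-1 * 2 `^ (b + 1) + (a + 1)^-1 * 2 `^ (a + 1))) => //.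
  - by move=> x x1; apply: cvgD; [exact: cB|exact: cD].
  - move=> x; rewrite /= in_itv/= => /andP[x1 x2].
    apply: (is_derive_eq
      (is_deriveB (is_deriveZ _ (derive_1D_powR _ x1))
      (is_deriveZ _ (derive_1B_powR _ x2)))).
    by rewrite /GRing.scale/= /f !addrK; field; rewrite !gt_eqF.
  - by move=> x _; rewrite addr_ge0// powR_ge0.
  - move=> n; rewrite /F.
    have := tail_inv_gt0 R n; have := tail_inv_lt1 R n => s0 s1.
    have h1 : (1 + hi n) `^ (b + 1) <= 2 `^ (b + 1).
      by apply: powR_2_le; rewrite /hi ?(ltW b10)//; apply/andP; lra.
    have h2 : (1 - lo n) `^ (a + 1) <= 2 `^ (a + 1).
      by apply: powR_2_le; rewrite /lo ?(ltW a10)//; apply/andP; lra.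
    have h3 := powR_ge0 (1 + lo n) (b + 1).
    have h4 := powR_ge0 (1 - hi n) (a + 1).
    move: h1 h2 h3 h4; rewrite -(ler_pM2l (x := (b + 1)^-1)) ?invr_gt0//.
    move=> h1; rewrite -(ler_pM2l (x := (a + 1)^-1)) ?invr_gt0// => h2 h3 h4.
    have h5 : 0 <= (b + 1)^-1 * (1 + lo n) `^ (b + 1)
      by rewrite mulr_ge0// invr_ge0 ltW.
    have h6 : 0 <= (a + 1)^-1 * (1 - hi n) `^ (a + 1)
      by rewrite mulr_ge0// invr_ge0 ltW.
    lra.
pose K : R := 2 `^ `|a| + 2 `^ `|b|.
apply: (@le_integrable _ _ _ mu `]-1, 1[%classic _ (EFin \o w)
  (fun t => K%:E * (EFin \o f) t)%E) => //.
- by apply/measurable_EFinP; apply: measurable_funTS;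
    exact: measurable_jacobi_weight.
- move=> x /= xI; have wx := jacobi_weight_gt0 xI.
  have fx : 0 <= f x by rewrite addr_ge0// powR_ge0.
  have K0 : 0 <= K by rewrite addr_ge0// powR_ge0.
  rewrite lee_fin !ger0_norm ?mulr_ge0 ?(ltW wx) ?powR_ge0//.
  move: xI; rewrite in_itv/= => /andP[x1 x2].
  have [x0|x0] := leP 0 x.
    have : (1 + x) `^ b <= 2 `^ `|b| by apply: powR_12_le; apply/andP; lra.
    move=> h; rewrite [leRHS]mulrC; apply: ler_pM; rewrite ?powR_ge0//.
      by rewrite lerDl powR_ge0.
    by rewrite (le_trans h)// lerDr powR_ge0.
  have : (1 - x) `^ a <= 2 `^ `|a| by apply: powR_12_le; apply/andP; lra.
  move=> h; apply: ler_pM; rewrite ?powR_ge0//.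
    by rewrite (le_trans h)// lerDl powR_ge0.
  by rewrite lerDr powR_ge0.
- by have := integrableZl _ K intf; apply.
Qed.

Lemma horner_bounded p :
  exists2 M : R, 0 <= M & forall x, -1 <= x <= 1 -> `|p.[x]| <= M.
Proof.
exists (\sum_(i < size p) `|p`_i|); first exact: sumr_ge0.
move=> x x1; rewrite horner_coef (le_trans (ler_norm_sum _ _ _))// ler_sum// =>
  i _.
by rewrite normrM normrX ler_piMr// exprn_ile1// ler_norml.
Qed.

Lemma integrable_poly_weight p :
  mu.-integrable `]-1, 1[ (EFin \o (fun x => p.[x] * w x)).
Proof.
have [M M0 pM] := horner_bounded p.
apply: (@le_integrable _ _ _ mu `]-1, 1[%classic _ _
  (fun t => M%:E * (EFin \o w) t)%E) => //.
- apply/measurable_EFinP; apply: measurable_funM.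
    by apply: measurable_funTS; apply: continuous_measurable_fun;
      exact: continuous_horner.
  by apply: measurable_funTS; exact: measurable_jacobi_weight.
- move=> x /= xI; have wx := jacobi_weight_gt0 xI.
  rewrite lee_fin normrM [leRHS]normrM (ger0_norm M0) ler_wpM2r// pM//.
  by move: xI; rewrite in_itv/= => /andP[/ltW -> /ltW ->].
- by have := integrableZl _ M integrable_jacobi_weight; apply.
Qed.

Definition jacobi_functional p : R :=
  \int[mu]_(x in `[-1, 1]) (p.[x] * w x).
Notation L := jacobi_functional.

(** The endpoints are a null set; on the open interval the weight is positive and continuous, and
    the exhaustion lemmas apply. *)
Lemma jacobi_functionalE p : L p = \int[mu]_(x in `]-1, 1[) (p.[x] * w x).
Proof.
have m (i : set R) : measurable_fun i (EFin \o (fun x => p.[x] * w x)).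
  apply/measurable_EFinP; apply: measurable_funM.
    by apply: measurable_funTS; apply: continuous_measurable_fun;
      exact: continuous_horner.
  by apply: measurable_funTS; exact: measurable_jacobi_weight.
by rewrite /L /Rintegral -integral_itv_obnd_cbnd// -integral_itv_bndo_bndc.
Qed.

Lemma jacobi_functionalD p q : L (p + q) = L p + L q.
Proof.
rewrite !jacobi_functionalE -RintegralD//; last 2 first.
- exact: integrable_poly_weight.
- exact: integrable_poly_weight.
by apply: eq_Rintegral => x _; rewrite hornerD mulrDl.
Qed.

Lemma jacobi_functionalZ c p : L (c *: p) = c * L p.
Proof.
rewrite !jacobi_functionalE -RintegralZl//; last exact: integrable_poly_weight.
by apply: eq_Rintegral => x _; rewrite hornerZ -mulrA.
Qed.

(* The integrand is the derivative of (1-x)^(a+1) (1+x)^(b+1) p(x), which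
   vanishes at both endpoints. *)
Lemma jacobi_functional_pearson p :
  L ((1 - 'X^2) * p^`() + ((b - a)%:P - (a + b + 2) *: 'X) * p) = 0.
Proof.
rewrite jacobi_functionalE.
pose F x : R := (1 - x) `^ (a + 1) * ((1 + x) `^ (b + 1) * p.[x]).
have a10 : 0 < a + 1 by move: a1; lra.
have b10 : 0 < b + 1 by move: b1; lra.
apply: (@Rintegral_antiderivative R lo hi _ _ _ _ _ _ _ F) => //.
- move=> x xI; apply: cvgM; first exact: continuous_horner.
  by apply: cvgM; [exact: cB|exact: cD].
- move=> x; rewrite /= in_itv/= => /andP[x1 x2].
  apply: (is_derive_eq
    (is_deriveM (derive_1B_powR _ x2)
    (is_deriveM (derive_1D_powR _ x1) (is_derive_poly p x)))).
  have e1 : (1 - x) `^ (a + 1) = (1 - x) `^ a * (1 - x).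
    by rewrite powRD ?powRr1//; [lra|apply/implyP => _; apply/eqP; lra].
  have e2 : (1 + x) `^ (b + 1) = (1 + x) `^ b * (1 + x).
    by rewrite powRD ?powRr1//; [lra|apply/implyP => _; apply/eqP; lra].
  rewrite !fctE /GRing.scale/=
    !addrK e1 e2 !(hornerD, hornerN, hornerM, hornerC, hornerZ, hornerX,
    hornerXn) /jacobi_weight; ring.
- exact: integrable_poly_weight.
have [M M0 pM] := horner_bounded p.
(* Here [t] stands for the factor that vanishes at the endpoint under consideration and [s] for the
   other one, so a single bound serves both ends. *)
have bnd c d s t x : 0 < c -> 0 < d -> 0 <= s <= 2 -> 0 <= t -> -1 <= x <= 1 ->
    `|t `^ c * (s `^ d * p.[x])| <= 2 `^ d * M * t `^ c.
  move=> c0 d0 s2 t0 x1;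
    rewrite normrM (ger0_norm (powR_ge0 _ _)) mulrC ler_wpM2r ?powR_ge0//.
  by rewrite normrM (ger0_norm (powR_ge0 _ _)) ler_pM ?powR_ge0 ?powR_2_le ?pM
    ?(ltW d0).
have sq c K (f : nat -> R) : 0 < c ->
  (forall n, `|f n| <= K * tail_inv R n `^ c) ->
    f n @[n --> \oo] --> 0.
  move=> c0 fK; have s0 : K * tail_inv R n `^ c @[n --> \oo] --> 0.
    by rewrite -[X in _ --> X](mulr0 K); apply: cvgMl_tmp;
      exact: powR_tail_inv_cvg0.
  apply: (@squeeze_cvgr _ _ _ _ (fun n => - (K * tail_inv R n `^ c))
    (fun n => K * tail_inv R n `^ c)) => //.
    by apply: nearW => n; rewrite -ler_norml.
  by rewrite -[X in _ --> X]oppr0; apply: cvgN.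
rewrite -[X in _ --> X](subr0 0); apply: cvgB.
- apply: (sq (a + 1) (2 `^ (b + 1) * M)) => // n; rewrite /F /hi.
  have := tail_inv_gt0 R n; have := tail_inv_lt1 R n => s1 s0.
  rewrite opprB addrCA subrr addr0; apply: bnd => //; try (by apply/andP; lra);
    lra.
- apply: (sq (b + 1) (2 `^ (a + 1) * M)) => // n; rewrite /F /lo.
  have := tail_inv_gt0 R n; have := tail_inv_lt1 R n => s1 s0.
  rewrite addrA subrr add0r mulrCA; apply: bnd => //; try (by apply/andP; lra);
    lra.
Qed.

(** If [p] were nonzero, the integrand would vanish in the open interval only at the finitely many
    roots of [p]; its support would then have measure 2, whereas a zero integral makes it null. *)
Lemma jacobi_functional_sqr_eq0 p : L (p ^+ 2) = 0 -> p = 0.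
Proof.
move=> Lp0; apply/eqP/negPn/negP => p0.
have : mu (`]-1, 1[ `&` [set x | p.[x] ^+ 2 * w x != 0]) = 0%E.
  apply: (@Rintegral_eq0_support R `]-1, 1[%classic (fun x => p.[x] ^+ 2 * w x))
    => //.
  - have := integrable_poly_weight (p ^+ 2); congr (_.-integrable _ _).
    by apply/funext => x /=; rewrite horner_exp.
  - by move=> x /jacobi_weight_gt0/ltW wx; rewrite mulr_ge0// sqr_ge0.
  - rewrite -Lp0 jacobi_functionalE; apply: eq_Rintegral => x _.
    by rewrite horner_exp.
set A := _ `&` _ => A0; pose I := `]-1, 1[%classic : set R.
pose rs : set R := [set x | p.[x] = 0].
have rs_fin : finite_set rs.
  apply: contrapT => /(@infinite_set_fset _ _ (size p)) [B Brs] /=;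
    rewrite leqNgt.
  rewrite max_poly_roots ?finmap.fset_uniq//; apply/allP => x xB; apply/rootP.
  exact: Brs.
have rs0 : mu rs = 0%E
  by exact/countable_lebesgue_measure0/finite_set_countable.
have mrs : measurable rs by apply: countable_measurable;
  [move=> t; exact: measurable_set1|exact: finite_set_countable].
have AE : A = I `\` rs.
  apply/seteqP; split => x [xI] /= pw; split => //=.
    by move=> /= px; move: pw; rewrite px expr0n mul0r eqxx.
  apply: mulf_neq0; first by rewrite sqrf_eq0; apply/eqP.
  by rewrite gt_eqF// jacobi_weight_gt0.
have mI : measurable I by exact: measurable_itv.
have mA : measurable A by rewrite AE; exact: measurableD.
have : (mu I <= mu A + mu rs)%E.
  have := measureU2 mu mA mrs; apply: le_trans.
  apply: (le_measure mu); rewrite ?inE//; first exact: measurableU.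
  rewrite AE.
  by move=> x xI; have [|] := pselect (rs x); [right|left].
rewrite A0 rs0 adde0 lebesgue_measure_itv/= lte_fin ifT; last by lra.
by rewrite -EFinB lee_fin; lra.
Qed.
End jacobi_functional.

(** * Jacobi polynomials *)

Section rising.
Variable R : realFieldType.
Implicit Types (x a b : R) (n k : nat).

(** The Pochhammer symbol (x)_k. *)
Definition rising x k : R := \prod_(i < k) (x + i%:R).

Lemma rising0 x : rising x 0 = 1.
Proof. by rewrite /rising big_ord0. Qed.

Lemma risingS x k : rising x k.+1 = rising x k * (x + k%:R).
Proof. by rewrite /rising big_ord_recr. Qed.

Lemma rising_gt0 x k : 0 < x -> 0 < rising x k.
Proof. by move=> x0; apply: prodr_gt0 => i _; rewrite ltr_wpDr. Qed.

(** Brings Pochhammer symbols with shifted bases to a common base, after which the contiguity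
    relations below are rational identities for [field]. *)
Lemma rising_shift x k : x != 0 ->
  rising (x + 1) k = rising x k * (x + k%:R) / x.
Proof.
move=> x0; elim: k => [|k IHk]; first by rewrite !rising0 addr0 mul1r divff.
by rewrite !risingS IHk -natr1; field.
Qed.

(* The coefficient of (1-x)^k in
   (a+1)_n / n! * 2F1(-n, n+a+b+1; a+1; (1-x)/2). *)
Definition jacobi_coef a b n k : R :=
  rising (a + 1) n / n`!%:R * 'C(n, k)%:R *
  (rising (n%:R + a + b + 1) k / rising (a + 1) k) * (- 2^-1) ^+ k.

Definition jacobi_poly a b n : {poly R} :=
  (\poly_(k < n.+1) jacobi_coef a b n k) \Po (1 - 'X).
End rising.

(** * Contiguity relations and the differential equation *)

Section jacobi_algebra.
Variables (R : realFieldType) (b : R).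
Hypothesis b1 : -1 < b.
Implicit Types (a : R) (n k : nat).

Let P a n : {poly R} := \poly_(k < n.+1) jacobi_coef a b n k.

(** The binomial coefficient vanishes for k > n, so the formula holds with no range condition and
    coefficients can be compared uniformly in k. *)
Let coefP a n k : (P a n)`_k = jacobi_coef a b n k.
Proof.
rewrite coef_poly; case: ltnP => // nk.
by rewrite /jacobi_coef bin_small// mulr0 !mul0r.
Qed.

Lemma binS_natr n k :
  (k.+1%:R * 'C(n, k.+1)%:R = (n%:R - k%:R) * 'C(n, k)%:R :> R).
Proof.
have [nk|kn] := ltnP n k; first by rewrite !bin_small ?mulr0// ltnW.
by rewrite -natrM mul_bin_left natrM natrB.
Qed.

(** The hypergeometric two-term recurrence; it is the Jacobi differential equation read
    coefficientwise in powers of 1-x. *)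
Lemma jacobi_coef_rec a n k : -1 < a ->
  2 * (k%:R + 1) * (k%:R + 1 + a) * jacobi_coef a b n k.+1 =
  - ((n%:R - k%:R) * (n%:R + k%:R + a + b + 1)) * jacobi_coef a b n k.
Proof.
move=> a1; rewrite /jacobi_coef !risingS exprS.
have h0 : a + 1 + k%:R != 0 by rewrite gt_eqF// ltr_wpDr//; lra.
have h1 : rising (a + 1) k != 0 by rewrite gt_eqF// rising_gt0//; lra.
have h2 : n`!%:R != 0 :> R by rewrite pnatr_eq0 -lt0n fact_gt0.
have := binS_natr n k; rewrite -natr1 => h3.
have h4 : k%:R + 1 != 0 :> R by rewrite natr1 pnatr_eq0.
have -> : 'C(n, k.+1)%:R = (n%:R - k%:R) * 'C(n, k)%:R / (k%:R + 1) :> R.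
  by rewrite -h3 mulrC mulKf.
by field; rewrite h0 h1 h2 h4.
Qed.

Let size_P a n : -1 < a -> size (P a n) = n.+1.
Proof.
move=> a1; rewrite size_poly_eq//= /jacobi_coef binn mulr1.
rewrite !mulf_neq0 ?invr_neq0 ?expf_neq0 ?oppr_eq0 ?pnatr_eq0 -?lt0n
  ?fact_gt0//.
- by rewrite gt_eqF// rising_gt0//; lra.
(* The base n+a+b+1 can be nonpositive only for n = 0, where the product is empty. *)
- case: n => [|n]; first by rewrite rising0 oner_eq0.
  rewrite gt_eqF// rising_gt0// -natr1; have := ler0n R n; move: b1; lra.
- by rewrite gt_eqF// rising_gt0//; lra.
Qed.

Lemma size_jacobi_poly a n : -1 < a -> size (jacobi_poly a b n) = n.+1.
Proof.
move=> a1; rewrite /jacobi_poly size_comp_poly2 ?size_P//.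
by rewrite -opprB size_polyN size_XsubC.
Qed.

Lemma jacobi_poly1 a n : (jacobi_poly a b n).[1] = rising (a + 1) n / n`!%:R.
Proof.
rewrite /jacobi_poly horner_comp hornerD hornerN hornerX hornerC subrr
  horner_coef0.
by rewrite coefP /jacobi_coef bin0 !rising0 expr0; field;
  rewrite pnatr_eq0 -lt0n fact_gt0.
Qed.

(** The contiguity relation that [jacobi_poly_raise_sum] telescopes. *)
Lemma jacobi_poly_shift a n : -1 < a ->
  (2 * n%:R + a + b + 3) *: jacobi_poly a b n.+1 =
  (n%:R + a + b + 2) *: jacobi_poly (a + 1) b n.+1 -
  (n%:R + b + 1) *: jacobi_poly (a + 1) b n.
Proof.
move=> a1; rewrite /jacobi_poly -!comp_polyZ -comp_polyB; congr (_ \Po _).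
apply/polyP => k; rewrite coefB !coefZ !coefP /jacobi_coef.
have a0 : a + 1 != 0 by rewrite gt_eqF//; lra.
have n0 : n%:R + a + b + 2 != 0 by rewrite gt_eqF//; have := ler0n R n;
  move: b1; lra.
rewrite [rising (a + 1 + 1) n.+1]rising_shift//
  [rising (a + 1 + 1) k]rising_shift// -!natr1.
have -> : n%:R + 1 + (a + 1) + b + 1 = (n%:R + a + b + 2) + 1 by ring.
have -> : n%:R + 1 + a + b + 1 = n%:R + a + b + 2 by ring.
have -> : n%:R + (a + 1) + b + 1 = n%:R + a + b + 2 by ring.
rewrite [rising (_ + 2 + 1) k]rising_shift//
  [rising (a + 1 + 1) n]rising_shift//.
rewrite !risingS.
have h0 : a + 1 + k%:R != 0 by rewrite gt_eqF// ltr_wpDr//; lra.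
have h1 : rising (a + 1) k != 0 by rewrite gt_eqF// rising_gt0//; lra.
have h2 : n`!%:R != 0 :> R by rewrite pnatr_eq0 -lt0n fact_gt0.
have h4 : n%:R + 1 != 0 :> R by rewrite natr1 pnatr_eq0.
have e : 'C(n, k)%:R = (n%:R + 1 - k%:R) * 'C(n.+1, k)%:R / (n%:R + 1) :> R.
  apply: (mulfI h4); rewrite [RHS]mulrC mulfVK// natr1 -natrM.
  have [nk|kn] := ltnP n.+1 k; first by rewrite !bin_small ?muln0 ?mulr0// ltnW.
  by rewrite (mul_bin_down n.+1 k) natrM natrB.
rewrite e factS natrM -[n.+1%:R]natr1.
by field; rewrite h0 h1 h2 h4 a0.
Qed.

Lemma jacobi_poly_raise a n : -1 < a ->
  (1 - 'X) * jacobi_poly (a + 2) b n =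
  (2 * (a + 1) / (n%:R + a + b + 2)) *: jacobi_poly (a + 1) b n -
  (2 * (n%:R + 1) / (n%:R + a + b + 2)) *: jacobi_poly a b n.+1.
Proof.
move=> a1; rewrite /jacobi_poly -!comp_polyZ -comp_polyB.
rewrite -[X in X * _ = _](comp_polyX (1 - 'X)) -comp_polyM; congr (_ \Po _).
apply/polyP => k; rewrite coefXM coefB !coefZ !coefP /jacobi_coef.
have a0 : a + 1 != 0 by rewrite gt_eqF//; lra.
have a2 : a + 2 != 0 by rewrite gt_eqF//; lra.
have n0 : n%:R + a + b + 2 != 0 by rewrite gt_eqF//; have := ler0n R n;
  move: b1; lra.
have h2 : n`!%:R != 0 :> R by rewrite pnatr_eq0 -lt0n fact_gt0.
have h4 : n%:R + 1 != 0 :> R by rewrite natr1 pnatr_eq0.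
(* Multiplication by the variable shifts coefficients by one, so at k = 0 the two terms on the right
   must cancel. *)
case: k => [|k] /=.
  rewrite !bin0 !rising0 [rising (a + 1 + 1) n]rising_shift// factS natrM
    -[n.+1%:R]natr1 risingS.
  by field; rewrite n0 h2 h4 a0.
have h0 : a + 1 + k%:R != 0 by rewrite gt_eqF// ltr_wpDr//; lra.
have h0' : a + 1 + 1 + k%:R != 0 by rewrite gt_eqF// ltr_wpDr//; lra.
have h1 : rising (a + 1) k != 0 by rewrite gt_eqF// rising_gt0//; lra.
have h5 : k%:R + 1 != 0 :> R by rewrite natr1 pnatr_eq0.
have -> : a + 2 + 1 = a + 1 + 1 + 1 by ring.
rewrite [rising (a + 1 + 1 + 1) n]rising_shift; last by rewrite -addrA.
rewrite [rising (a + 1 + 1 + 1) k]rising_shift; last by rewrite -addrA.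
rewrite [rising (a + 1 + 1) n]rising_shift//
  [rising (a + 1 + 1) k.+1]rising_shift// [rising (a + 1 + 1) k]rising_shift//.
have -> : n%:R + (a + 2) + b + 1 = (n%:R + a + b + 2) + 1 by ring.
rewrite -[n.+1%:R]natr1.
have -> : n%:R + 1 + a + b + 1 = n%:R + a + b + 2 by ring.
have -> : n%:R + (a + 1) + b + 1 = n%:R + a + b + 2 by ring.
rewrite [rising (_ + 2 + 1) k]rising_shift// !risingS exprS.
have e1 : 'C(n, k.+1)%:R = (n%:R - k%:R) * 'C(n, k)%:R / (k%:R + 1) :> R.
  by rewrite -binS_natr -natr1 mulrC mulKf.
have e2 : 'C(n.+1, k.+1)%:R = (n%:R + 1) * 'C(n, k)%:R / (k%:R + 1) :> R.
  by apply: (mulfI h5); rewrite [RHS]mulrC mulfVK// !natr1 -!natrM mul_bin_diag.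
rewrite e1 e2 factS natrM -!natr1.
have h6 : a + 1 + (k%:R + 1) != 0
  by have -> : a + 1 + (k%:R + 1) = a + 1 + 1 + k%:R by ring.
have h7 : a + 1 + 1 != 0 by have -> : a + 1 + 1 = a + 2 by ring.
by field; rewrite h0 h1 h2 h4 h5 h6 h7 a0 n0.
Qed.

Lemma jacobi_poly_ode a n : -1 < a ->
  let J := jacobi_poly a b n in
  (1 - 'X^2) * J^`()^`() + ((b - a)%:P - (a + b + 2) *: 'X) * J^`() =
  (- (n%:R * (n%:R + a + b + 1))) *: J.
Proof.
move=> a1 J; pose Y : {poly R} := 1 - 'X.
have dY : Y^`() = -1 by rewrite derivB derivX derivC sub0r.
have dJ : J^`() = - ((P a n)^`() \Po Y) by rewrite deriv_comp dY mulrN1.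
have ddJ : J^`()^`() = (P a n)^`()^`() \Po Y.
  by rewrite dJ derivN deriv_comp dY mulrN1 opprK.
(* The same operator in the variable y = 1-x: 1-x^2 becomes 2y-y^2, and the sign from the chain rule
   turns the first-order coefficient into 2(a+1)-(a+b+2)y. *)
pose Q := (2 *: 'X - 'X^2) * (P a n)^`()^`() +
  ((2 * (a + 1))%:P - (a + b + 2) *: 'X) * (P a n)^`().
transitivity (Q \Po Y).
  rewrite ddJ dJ /Q expr2
    !(comp_polyB, comp_polyD, comp_polyM, comp_polyZ, comp_polyX, comp_polyC).
  by rewrite -!mul_polyC !(polyCB, polyCD, polyCM) polyC1 /Y; ring.
rewrite /J /jacobi_poly -comp_polyZ; congr (_ \Po _).
have coef_derivS (p : {poly R}) k : p^`()`_k = k.+1%:R * p`_k.+1.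
  by rewrite coef_deriv mulr_natl.
apply/polyP => k; rewrite /Q !mulrBl -!mul_polyC -!mulrA.
rewrite !(coefB, coefD, coefCM, coefXM, coefXnM, coef_derivS) !coefP.
(* The operator sends y^k to a combination of y^k and y^(k-1), so only two neighbouring coefficients
   enter. *)
transitivity (2 * (k%:R + 1) * (k%:R + 1 + a) * jacobi_coef a b n k.+1 -
    k%:R * (k%:R + a + b + 1) * jacobi_coef a b n k).
  by case: k => [|[|k]] /=; ring.
by rewrite jacobi_coef_rec//; ring.
Qed.
End jacobi_algebra.

(** * Polynomial families with one member in each degree *)

Section graded_family.
Variables (R : fieldType) (Q : nat -> {poly R}).
Hypothesis sizeQ : forall n, size (Q n) = n.+1.

Lemma coef_graded_neq0 n : (Q n)`_n != 0.
Proof.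
have := lead_coefE (Q n); rewrite sizeQ /= => <-.
by rewrite lead_coef_eq0 -size_poly_eq0 sizeQ.
Qed.

Lemma size_sub_graded (p : {poly R}) n : (size p <= n.+1)%N ->
  (size (p - (p`_n / (Q n)`_n) *: Q n)%R <= n)%N.
Proof.
move=> sp; apply/leq_sizeP => j; rewrite leq_eqVlt => /predU1P[<-|nj].
  by rewrite coefB coefZ divfK ?subrr// coef_graded_neq0.
rewrite coefB coefZ (nth_default _ (leq_trans sp nj)) [(Q n)`_j]nth_default
  ?mulr0 ?subrr//.
by rewrite sizeQ.
Qed.

(** Only the last member reaches the top degree, so its coefficient vanishes; then descend. *)
Lemma graded_family_free (e : nat -> R) M :
  \sum_(l < M) e l *: Q l = 0 -> forall l, (l < M)%N -> e l = 0.
Proof.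
elim: M => // M IHM; rewrite big_ord_recr/= => eM.
have /eqP : (\sum_(l < M) e l *: Q l + e M *: Q M)`_M = 0 by rewrite eM coef0.
rewrite coefD coef_sum big1 => [|l _]; last first.
  by rewrite coefZ nth_default ?mulr0// sizeQ.
rewrite add0r coefZ mulf_eq0 (negbTE (coef_graded_neq0 M)) orbF => /eqP eM0.
move=> l; rewrite ltnS leq_eqVlt => /predU1P[-> //|]; apply: IHM.
by move: eM; rewrite eM0 scale0r addr0.
Qed.

End graded_family.

(** * Orthogonality and uniqueness *)

Section jacobi_family.
Variables (R : realType) (a b : R).
Hypotheses (a1 : -1 < a) (b1 : -1 < b).
Notation L := (jacobi_functional a b).
Notation J := (jacobi_poly a b).

Lemma jacobi_poly_symmetry (r : {poly R}) n :
  n%:R * (n%:R + a + b + 1) * L (r * J n) =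
    L ((1 - 'X^2) * (r^`() * (J n)^`())).
Proof.
have := jacobi_functional_pearson a1 b1 (r * (J n)^`()).
have -> : (1 - 'X^2) * (r * (J n)^`())^`() +
  ((b - a)%:P - (a + b + 2) *: 'X) * (r * (J n)^`()) =
  (1 - 'X^2) * (r^`() * (J n)^`()) + (- (n%:R * (n%:R + a + b + 1))) *:
    (r * J n).
  by rewrite scalerAr -(jacobi_poly_ode b n a1) derivM; ring.
rewrite jacobi_functionalD// jacobi_functionalZ// mulNr => /eqP.
by rewrite subr_eq0 => /eqP.
Qed.

(** By symmetry the difference of the eigenvalues annihilates L(J_m J_n). It factors as
    (n-m)(n+m+a+b+1), and m < n forces n >= 1, which makes the second factor positive. *)
Lemma jacobi_poly_orthogonal m n : m <> n -> L (J m * J n) = 0.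
Proof.
wlog mn : m n / (m < n)%N => [hw mn|_].
  have [|nm|] := ltngtP m n => //; first by move=> h; exact: hw.
  by rewrite mulrC; apply: hw => //; exact/nesym.
have := jacobi_poly_symmetry (J m) n;
  rewrite [_^`() * _]mulrC -jacobi_poly_symmetry.
rewrite [J n * _]mulrC => /eqP;
  rewrite -subr_eq0 -mulrBl mulf_eq0 => /orP[|/eqP//].
have -> : n%:R * (n%:R + a + b + 1) - m%:R * (m%:R + a + b + 1) =
   (n%:R - m%:R) * (n%:R + m%:R + a + b + 1) :> R by ring.
rewrite mulf_eq0 subr_eq0 eqr_nat gtn_eqF//= => /eqP.
case: n mn => // n _; rewrite -natr1; have := ler0n R n; have := ler0n R m.
by move: a1 b1; lra.
Qed.

Lemma is_jacobi_functional P : is_jacobi a b P ->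
  forall m n, m <> n -> L (P m * P n) = 0.
Proof.
case=> _ + _ m n mn => /(_ _ _ mn) <-.
by apply: eq_Rintegral => x _; rewrite hornerM.
Qed.

Lemma is_jacobi_poly : is_jacobi a b J.
Proof.
split=> [n|m n mn|n]; first exact: size_jacobi_poly.
  rewrite -(jacobi_poly_orthogonal mn).
  by apply: eq_Rintegral => x _; rewrite hornerM.
exact: jacobi_poly1.
Qed.

(** Induction on the degree bound: subtracting a multiple of the family member of top degree, which
    is orthogonal to [P n], lowers the degree. *)
Lemma orthogonal_lower_degree P n (p : {poly R}) : is_jacobi a b P ->
  (size p <= n)%N -> L (P n * p) = 0.
Proof.
move=> jP; have orthP := is_jacobi_functional jP; have [sizeP _ _] := jP.
suff h m : (m <= n)%N -> forall q : {poly R}, (size q <= m)%N ->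
  L (P n * q) = 0.
  exact: h (leqnn n) p.
elim: m => [|m IHm] mn q sq.
  move: sq; rewrite leqn0 size_poly_eq0 => /eqP ->.
  by rewrite mulr0 -(scale0r (0 : {poly R})) jacobi_functionalZ// mul0r.
have := size_sub_graded sizeP sq; set c := _ / _ => /(IHm (ltnW mn)) h.
rewrite -[q](subrK (c *: P m)) mulrDr jacobi_functionalD// h add0r.
by rewrite -scalerAr jacobi_functionalZ// orthP ?mulr0// => nm; move: mn;
  rewrite nm ltnn.
Qed.

(** Choose [c] so that [D], the difference of [P n] and [c *: J n], has lower degree. Then [D] is
    orthogonal to both, hence to itself, and vanishes; the common nonzero value at 1 gives c = 1. *)
Lemma is_jacobi_unique P : is_jacobi a b P -> P = J.
Proof.
move=> jP; apply/funext => n; have [sizeP _ P1] := jP.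
have sizeJ k : size (J k) = k.+1 by exact: size_jacobi_poly.
pose c := (P n)`_n / (J n)`_n; pose D := P n - c *: J n.
have sD : (size D <= n)%N by apply: size_sub_graded => //; rewrite sizeP.
have : L (D ^+ 2) = 0.
  have -> : D ^+ 2 = P n * D + (- c) *: (J n * D).
    by rewrite expr2 {1}/D mulrBl -scalerAl scaleNr.
  rewrite jacobi_functionalD// jacobi_functionalZ//.
  by rewrite (orthogonal_lower_degree jP)//
    (orthogonal_lower_degree is_jacobi_poly)// mulr0 addr0.
move/(jacobi_functional_sqr_eq0 a1 b1)/eqP; rewrite subr_eq0 => /eqP PJ.
have J1 : (J n).[1] != 0.
  rewrite jacobi_poly1 mulf_neq0 ?invr_neq0 ?pnatr_eq0 -?lt0n ?fact_gt0//.
  by rewrite gt_eqF// rising_gt0//; move: a1; lra.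
have : c * (J n).[1] = 1 * (J n).[1].
  by have := congr1 (fun p => p.[1]) PJ; rewrite hornerZ P1 mul1r jacobi_poly1.
by move/(mulIf J1) => c1; rewrite PJ c1 scale1r.
Qed.

Lemma jacobiE : jacobi a b = J.
Proof.
apply: is_jacobi_unique; rewrite /jacobi.
by case: xgetP => [P _ //|/(_ J)]; case; exact: is_jacobi_poly.
Qed.

End jacobi_family.

(** * Connection coefficients *)

Section connection.
Variables (R : realType) (b : R).
Hypothesis b1 : -1 < b.
Implicit Types (a x : R) (n l : nat).

Lemma shifted_GammaS a n : shifted_Gamma a b n.+1 =
  (2 * n%:R + a + b + 3) * Gamma (n%:R + a + b + 2).
Proof.
by rewrite /shifted_Gamma /= -natr1; congr (_ * Gamma _); ring.
Qed.

Lemma shifted_Gamma_gt0 a n : -1 < a -> 0 < shifted_Gamma a b n.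
Proof.
move=> a1; case: n => [|n].
  by rewrite shifted_Gamma0// Gamma_gt0//; move: b1; lra.
have := ler0n R n => n0.
rewrite shifted_GammaS mulr_gt0 ?Gamma_gt0//; move: b1; lra.
Qed.

(** The value at 1 is left symbolic: where this is applied it cancels between numerator and
    denominator. *)
Lemma Gamma_natr n : Gamma (n%:R + 1) = n`!%:R * Gamma (1 : R).
Proof.
elim: n => [|n IHn]; first by rewrite add0r mul1r.
by rewrite -[n.+1%:R]natr1 GammaS ?IHn ?factS ?natrM -?natr1 ?mulrA// ltr_wpDl.
Qed.

Lemma jacobi_poly0 a : jacobi_poly a b 0 = 1.
Proof.
rewrite /jacobi_poly -[RHS](comp_polyC 1 (1 - 'X)); congr (_ \Po _).
apply/polyP => k; rewrite coef_poly coefC ltnS leqn0; case: eqP => // ->.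
by rewrite /jacobi_coef bin0 !rising0 fact0 divr1 expr0 !mulr1.
Qed.

(** With these Gamma factors, [jacobi_poly_shift] says that consecutive left sides differ by exactly
    the new summand. The base case rests on [shifted_Gamma0]. *)
Lemma jacobi_poly_raise_sum a n : -1 < a ->
  (Gamma (n%:R + a + b + 2) / Gamma (n%:R + b + 1)) *: jacobi_poly (a + 1) b n =
  \sum_(l < n.+1) (shifted_Gamma a b l / Gamma (l%:R + b + 1)) *:
    jacobi_poly a b l.
Proof.
move=> a1; elim: n => [|n IHn].
  by rewrite big_ord1 shifted_Gamma0// !jacobi_poly0 add0r.
rewrite big_ord_recr/= -IHn shifted_GammaS -natr1.
have n0 := ler0n R n.
have -> : n%:R + 1 + a + b + 2 = (n%:R + a + b + 2) + 1 by ring.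
have -> : n%:R + 1 + b + 1 = (n%:R + b + 1) + 1 by ring.
have x1 : 0 < n%:R + a + b + 2 by move: b1; lra.
have x2 : 0 < n%:R + b + 1 by move: b1; lra.
rewrite (GammaS x1) (GammaS x2); set g1 := Gamma (n%:R + a + b + 2);
  set g2 := Gamma (n%:R + b + 1).
have g10 : g1 != 0 by exact: Gamma_neq0.
have g20 : g2 != 0 by exact: Gamma_neq0.
have := jacobi_poly_shift b1 n a1.
set A := jacobi_poly a b n.+1; set B := jacobi_poly (a + 1) b n.+1;
  set C := jacobi_poly (a + 1) b n.
move=> e; have -> : ((2 * n%:R + a + b + 3) * g1 / ((n%:R + b + 1) * g2)) *: A =
   (g1 / ((n%:R + b + 1) * g2)) *: ((2 * n%:R + a + b + 3) *: A).
  by rewrite scalerA; congr (_ *: _); ring.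
rewrite e scalerBr !scalerA [RHS]addrCA -[in RHS]scalerBl.
have -> : g1 / g2 - g1 / ((n%:R + b + 1) * g2) * (n%:R + b + 1) = 0.
  by field; rewrite g20 gt_eqF.
by rewrite scale0r addr0; congr (_ *: _); ring.
Qed.

(** The radicand of the normalizing factor; classically the reciprocal of the squared norm of P_n,
    not the norm itself. *)
Definition jacobi_norm a n : R :=
  shifted_Gamma a b n * n`!%:R /
    (2 `^ (a + b + 1) * Gamma (n%:R + a + 1) * Gamma (n%:R + b + 1)).

Lemma jacobi_norm_gt0 a n : -1 < a -> 0 < jacobi_norm a n.
Proof.
move=> a1; have n0 := ler0n R n.
apply: divr_gt0.
  by apply: mulr_gt0; [exact: shifted_Gamma_gt0|rewrite ltr0n fact_gt0].
apply: mulr_gt0; last by apply: Gamma_gt0; move: b1; lra.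
by apply: mulr_gt0; [exact: powR_gt0|apply: Gamma_gt0; lra].
Qed.

Lemma orthonormal_jacobiE a n : -1 < a ->
  orthonormal_jacobi a b n = Num.sqrt (jacobi_norm a n) *: jacobi_poly a b n.
Proof. by move=> a1; rewrite /orthonormal_jacobi jacobiE. Qed.

Lemma size_orthonormal_jacobi a n : -1 < a ->
  size (orthonormal_jacobi a b n) = n.+1.
Proof.
move=> a1; rewrite orthonormal_jacobiE// size_scale ?size_jacobi_poly//.
by rewrite sqrtr_eq0 -ltNge jacobi_norm_gt0.
Qed.

Variable a : R.
Hypothesis a1 : -1 < a.

(** The radicand of the coefficients with l <= n splits into a factor in l and a factor in n
    ([connection_col]): this is the rank-one structure. *)
Definition connection_row l : R :=
  shifted_Gamma a b l * Gamma (l%:R + a + 1) /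
    (Gamma (l%:R + b + 1) * Gamma (l%:R + 1)).

Definition connection_col n : R :=
  (2 * n%:R + a + b + 3) * Gamma (n%:R + b + 1) * Gamma (n%:R + 1) /
    (Gamma (n%:R + a + b + 3) * Gamma (n%:R + a + 3)).

Definition connection_coef l n : R :=
  if (l <= n)%N then (a + 1) * Num.sqrt (connection_row l * connection_col n)
  else if l == n.+1 then - givens_sin a b n
  else 0.

Lemma connection_row_gt0 l : 0 < connection_row l.
Proof.
have l0 := ler0n R l.
apply: divr_gt0; apply: mulr_gt0; try by apply: Gamma_gt0; move: a1 b1; lra.
exact: shifted_Gamma_gt0.
Qed.

Lemma connection_col_gt0 n : 0 < connection_col n.
Proof.
have n0 := ler0n R n.
have np : 0 < 2 * n%:R + a + b + 3 by move: a1 b1; lra.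
apply: divr_gt0; apply: mulr_gt0; try by apply: Gamma_gt0; move: a1 b1; lra.
by apply: mulr_gt0 => //; apply: Gamma_gt0; move: b1; lra.
Qed.

(** Since a+2+b > 0, the exceptional case of [shifted_Gamma] cannot occur. Extracting 4 leaves the
    power of 2 found in [jacobi_norm a], so that it cancels. *)
Lemma jacobi_norm_add2 n : jacobi_norm (a + 2) n =
  (2 * n%:R + a + b + 3) * Gamma (n%:R + a + b + 3) * n`!%:R /
  (4 * 2 `^ (a + b + 1) * Gamma (n%:R + a + 3) * Gamma (n%:R + b + 1)).
Proof.
rewrite /jacobi_norm /shifted_Gamma [_ == -1]gt_eqF; last by move: a1 b1; lra.
rewrite andbF.
have -> : n%:R + (a + 2) + 1 = n%:R + a + 3 by ring.
have -> : n%:R + (a + 2) + b + 1 = n%:R + a + b + 3 by ring.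
have -> : 2 * n%:R + (a + 2) + b + 1 = 2 * n%:R + a + b + 3 by ring.
have -> : a + 2 + b + 1 = 2%:R + (a + b + 1) by ring.
have -> : 2 `^ (2%:R + (a + b + 1)) = 4 * 2 `^ (a + b + 1) :> R.
  rewrite (@powRD R 2 2%:R); last by apply/implyP => _; rewrite pnatr_eq0.
  by rewrite powR_mulrn// -natrX.
by [].
Qed.

Lemma mulr_sqrt k x : 0 <= k -> k * Num.sqrt x = Num.sqrt (k ^+ 2 * x).
Proof. by move=> k0; rewrite sqrtrM ?sqr_ge0// sqrtr_sqr ger0_norm. Qed.

(** The right side is the coefficient of [jacobi_poly a b l] obtained from [jacobi_poly_raise] and
    [jacobi_poly_raise_sum]. All factors are nonnegative, so each side becomes one square root and
    the radicands are compared. *)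
Lemma connection_coef_le l n : (l <= n)%N ->
  connection_coef l n * Num.sqrt (jacobi_norm a l) =
  Num.sqrt (jacobi_norm (a + 2) n) *
    (2 * (a + 1) / (n%:R + a + b + 2) *
      (Gamma (n%:R + b + 1) / Gamma (n%:R + a + b + 2)) *
     (shifted_Gamma a b l / Gamma (l%:R + b + 1))).
Proof.
move=> ln; rewrite /connection_coef ln.
have n0 := ler0n R n; have l0 := ler0n R l.
have a10 : 0 < a + 1 by move: a1; lra.
have nb : 0 < n%:R + b + 1 by move: b1; lra.
have lb : 0 < l%:R + b + 1 by move: b1; lra.
have la : 0 < l%:R + a + 1 by move: a1; lra.
have nab : 0 < n%:R + a + b + 2 by move: a1 b1; lra.
have na : 0 < n%:R + a + 3 by move: a1; lra.
have a21 : -1 < a + 2 by move: a1; lra.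
have SG0 := shifted_Gamma_gt0 l a1.
rewrite (mulr_sqrt _ (ltW a10)) -sqrtrM; last first.
  apply: mulr_ge0; first exact: sqr_ge0.
  by apply: mulr_ge0; apply: ltW;
    [exact: connection_row_gt0|exact: connection_col_gt0].
rewrite [RHS]mulrC mulr_sqrt; last first.
  apply: ltW; apply: mulr_gt0; last by apply: divr_gt0 => //; exact: Gamma_gt0.
  apply: mulr_gt0; last by apply: divr_gt0; exact: Gamma_gt0.
  by apply: divr_gt0 => //; exact: mulr_gt0.
congr Num.sqrt; rewrite jacobi_norm_add2 /connection_row /connection_col
  /jacobi_norm.
have -> : n%:R + a + b + 3 = n%:R + a + b + 2 + 1 by ring.
rewrite !Gamma_natr (GammaS nab).
have h0 := lt0r_neq0 SG0.
have h1 := Gamma_neq0 nb; have h2 := Gamma_neq0 lb; have h3 := Gamma_neq0 la;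
  have h4 := Gamma_neq0 nab.
have h5 := Gamma_neq0 na; have h6 := Gamma_neq0 (@ltr01 R);
  have h7 := lt0r_neq0 nab.
have h8 : 2 `^ (a + b + 1) != 0 :> R by rewrite gt_eqF// powR_gt0.
have h9 : n`!%:R != 0 :> R by rewrite pnatr_eq0 -lt0n fact_gt0.
have h10 : l`!%:R != 0 :> R by rewrite pnatr_eq0 -lt0n fact_gt0.
by field; rewrite ?h0 ?h1 ?h2 ?h3 ?h4 ?h5 ?h6 ?h7 ?h8 ?h9 ?h10.
Qed.

Lemma connection_coef_succ n :
  givens_sin a b n * Num.sqrt (jacobi_norm a n.+1) =
  Num.sqrt (jacobi_norm (a + 2) n) * (2 * (n%:R + 1) / (n%:R + a + b + 2)).
Proof.
have n0 := ler0n R n.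
have nb : 0 < n%:R + b + 1 by move: b1; lra.
have nab : 0 < n%:R + a + b + 2 by move: a1 b1; lra.
have nab3 : 0 < 2 * n%:R + a + b + 3 by move: a1 b1; lra.
have na : 0 < n%:R + a + 2 by move: a1; lra.
have n1 : 0 < n%:R + 1 :> R by lra.
rewrite -sqrtrM; last by rewrite divr_ge0 ?mulr_ge0 ?ltW.
rewrite [RHS]mulrC mulr_sqrt; last by rewrite divr_ge0 ?mulr_ge0 ?ltW.
congr Num.sqrt; rewrite jacobi_norm_add2 /jacobi_norm shifted_GammaS
  -[n.+1%:R]natr1.
have -> : n%:R + a + b + 3 = n%:R + a + b + 2 + 1 by ring.
have -> : n%:R + 1 + a + 1 = n%:R + a + 2 by ring.
have -> : n%:R + a + 3 = n%:R + a + 2 + 1 by ring.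
have -> : n%:R + 1 + b + 1 = n%:R + b + 1 + 1 by ring.
rewrite (GammaS nab) (GammaS nb) (GammaS na) factS natrM -[n.+1%:R]natr1.
have h1 := Gamma_neq0 nb; have h2 := Gamma_neq0 nab; have h3 := Gamma_neq0 na.
have h4 := lt0r_neq0 nb; have h5 := lt0r_neq0 nab; have h6 := lt0r_neq0 na.
have h7 := lt0r_neq0 n1.
have h8 : 2 `^ (a + b + 1) != 0 :> R by rewrite gt_eqF// powR_gt0.
have h9 : n`!%:R != 0 :> R by rewrite pnatr_eq0 -lt0n fact_gt0.
by field; rewrite ?h1 ?h2 ?h3 ?h4 ?h5 ?h6 ?h7 ?h8 ?h9.
Qed.

(** The first term of [jacobi_poly_raise] spreads over all l <= n, and the second is the single
    entry l = n+1. *)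
Lemma connection_expansion n :
  (1 - 'X) * orthonormal_jacobi (a + 2) b n =
  \sum_(l < n.+2) connection_coef l n *: orthonormal_jacobi a b l.
Proof.
have a21 : -1 < a + 2 by move: a1; lra.
have n0 := ler0n R n.
have nb : 0 < n%:R + b + 1 by move: b1; lra.
have nab : 0 < n%:R + a + b + 2 by move: a1 b1; lra.
rewrite orthonormal_jacobiE// -scalerAr (jacobi_poly_raise b1 n a1).
have -> : jacobi_poly (a + 1) b n =
    (Gamma (n%:R + b + 1) / Gamma (n%:R + a + b + 2)) *:
    \sum_(l < n.+1) (shifted_Gamma a b l / Gamma (l%:R + b + 1)) *:
      jacobi_poly a b l.
  rewrite -jacobi_poly_raise_sum// scalerA mulrA divfK ?divff ?scale1r
    ?Gamma_neq0//.
rewrite [RHS]big_ord_recr/= scalerBr; congr (_ + _).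
  rewrite scalerA !scaler_sumr; apply: eq_bigr => l _.
  by rewrite (orthonormal_jacobiE _ a1) !scalerA connection_coef_le ?mulrA//
    -ltnS.
rewrite (orthonormal_jacobiE _ a1) /connection_coef ltnn eqxx !scalerA mulNr.
by rewrite connection_coef_succ scaleNr.
Qed.

(** Existence is the expansion padded with zeros; uniqueness is linear independence of a family with
    one member in each degree. *)
Lemma connection_coefficientsP (c : nat -> nat -> R) :
  let p := fun n => (1 - 'X) * orthonormal_jacobi (a + 2) b n in
  connection_coefficients p (orthonormal_jacobi a b) c <->
  forall l n, c l n = connection_coef l n.
Proof.
move=> p; have pad n M : (n.+2 <= M)%N ->
    p n = \sum_(l < M) connection_coef l n *: orthonormal_jacobi a b l.
  move=> nM; rewrite /p connection_expansion
    (big_ord_widen _ (fun l => connection_coef l n *: orthonormal_jacobi a b l)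
    nM).
  rewrite [RHS](bigID (fun l : 'I_M => l < n.+2)%N)/=
    [X in _ + X]big1 ?addr0// => l.
  rewrite -leqNgt => nl;
    rewrite /connection_coef leqNgt (leq_trans (leqnSn _) nl)/=.
  by rewrite gtn_eqF// scale0r.
split=> [cc l n|cE n]; last first.
  exists n.+2; split; last by rewrite (pad n n.+2)//; apply: eq_bigr => l _;
    rewrite cE.
  move=> l nl; rewrite cE /connection_coef leqNgt (leq_trans (leqnSn _) nl)/=.
  by rewrite gtn_eqF.
have [M [cM pM]] := cc n.
(* A common length: both expansions are padded to it, and it exceeds the index [l] in question. *)
pose K := maxn l.+1 (maxn M n.+2).
have MK : (M <= K)%N by rewrite /K leq_max leq_max leqnn orbT.
have nK : (n.+2 <= K)%N by rewrite /K !leq_max leqnn !orbT.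
have lK : (l < K)%N by rewrite /K leq_max leqnn.
apply/eqP; rewrite -subr_eq0; apply/eqP.
apply: (graded_family_free (fun k => size_orthonormal_jacobi k a1)
  (e := fun l => c l n - connection_coef l n) _ lK).
under eq_bigr do rewrite scalerBl.
rewrite sumrB -pad// pM
  (big_ord_widen _ (fun l => c l n *: orthonormal_jacobi a b l) MK).
apply/eqP; rewrite subr_eq0; apply/eqP.
rewrite [LHS](bigID (fun l : 'I_K => l < M)%N)/= [X in _ + X]big1 ?addr0// => k.
by rewrite -leqNgt => /cM ->; rewrite scale0r.
Qed.

End connection.

(** * Products of Givens rotations *)

Section givens_product.
Variables (R : realType) (a b : R).
Hypotheses (a1 : -1 < a) (b1 : -1 < b).
Implicit Types (n l m : nat).

Lemma mulmx_givens K m (A : 'M[R]_K) (i0 i1 l j : 'I_K) :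
  i0 = m :> nat -> i1 = m.+1 :> nat ->
  (A *m givens a b K m) l j =
    if j == i0 then givens_cos a b m * A l i0 - givens_sin a b m * A l i1
    else if j == i1 then givens_sin a b m * A l i0 + givens_cos a b m * A l i1
    else A l j.
Proof.
move=> e0 e1; have ne : i1 != i0 by rewrite -val_eqE /= e0 e1 gtn_eqF.
have G k : givens a b K m k j =
    if j == i0 then
      if k == i0 then givens_cos a b m
      else if k == i1 then - givens_sin a b m else 0
    else if j == i1 then
      if k == i0 then givens_sin a b m
      else if k == i1 then givens_cos a b m else 0
    else (k == j)%:R.
  rewrite mxE -!val_eqE /= e0 e1.
  have [km|km] := eqVneq (k : nat) m; have [jm|jm] := eqVneq (j : nat) m;
    have [km1|km1] := eqVneq (k : nat) m.+1;
      have [jm1|jm1] := eqVneq (j : nat) m.+1 => //=; try lia.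
    by rewrite jm (negbTE km).
  by rewrite jm1 (negbTE km1).
rewrite mxE (bigD1 i0)//= (bigD1 i1)//= !G eqxx (negbTE ne) eqxx.
have [j0|j0] := eqVneq j i0.
  rewrite big1 ?addr0 => [|k /andP[k0 k1]];
    last by rewrite G j0 eqxx (negbTE k0) (negbTE k1) mulr0.
  ring.
have [j1|j1] := eqVneq j i1.
  rewrite big1 ?addr0 => [|k /andP[k0 k1]];
    last by rewrite G (negbTE j0) j1 eqxx (negbTE k0) (negbTE k1) mulr0.
  ring.
rewrite !mulr0 !add0r (bigD1 j)/=; last by rewrite j0 j1.
rewrite G (negbTE j0) (negbTE j1) eqxx mulr1 big1 ?addr0// => k /andP[_ kj].
by rewrite G (negbTE j0) (negbTE j1) (negbTE kj) mulr0.
Qed.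

(* The entry in row [l] and column [n] of G_0 ... G_(n-1): this column is
   touched once more, by G_n, before it becomes column [n] of the full
   product. *)
Definition givens_column n l : R :=
  if (l <= n)%N then
    Num.sqrt ((a + 1) * (connection_row b a l *
      (Gamma (n%:R + b + 1) * Gamma (n%:R + 1) /
       (Gamma (n%:R + a + b + 2) * Gamma (n%:R + a + 2)))))
  else 0.

(** The start of the induction: the empty product is the identity, and the Gamma factors at l = 0
    must cancel to 1. *)
Lemma givens_column0 l : givens_column 0 l = (l == 0%N)%:R.
Proof.
rewrite /givens_column leqn0; case: eqP => // ->.
have a10 : 0 < a + 1 by move: a1; lra.
have b10 : 0 < b + 1 by move: b1; lra.
have ab2 : 0 < a + b + 2 by move: a1 b1; lra.
rewrite -[RHS](sqrtr1 R); congr Num.sqrt.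
rewrite /connection_row (shifted_Gamma0 a1 b1) !add0r.
have -> : a + 2 = a + 1 + 1 by ring.
rewrite (GammaS a10).
by field; rewrite ?Gamma_neq0 ?gt_eqF.
Qed.

Let factors_gt0 n :
  [/\ 0 < n%:R + b + 1, 0 < n%:R + a + b + 2, 0 < n%:R + a + 2,
      0 < n%:R + 1 :> R & 0 < 2 * n%:R + a + b + 3].
Proof. by have n0 := ler0n R n; split; move: a1 b1; lra. Qed.

(** How G_n produces the next active column: column n+1 is still a unit vector when G_n mixes it
    with column n. *)
Lemma givens_columnS n l :
  givens_column n.+1 l =
    givens_sin a b n * givens_column n l + givens_cos a b n * (l == n.+1)%:R.
Proof.
have [nb nab na n1 n3] := factors_gt0 n.
have g1 := Gamma_neq0 nb; have g2 := Gamma_neq0 nab; have g3 := Gamma_neq0 na;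
  have g4 := Gamma_neq0 n1.
have h1 := lt0r_neq0 nb; have h2 := lt0r_neq0 nab; have h3 := lt0r_neq0 na;
  have h4 := lt0r_neq0 n1.
have a10 : 0 < a + 1 by move: a1; lra.
have e1 : n%:R + 1 + a + b + 2 = n%:R + a + b + 2 + 1 by ring.
have e2 : n%:R + 1 + a + 2 = n%:R + a + 2 + 1 by ring.
have e3 : n%:R + 1 + b + 1 = n%:R + b + 1 + 1 by ring.
rewrite /givens_column; have [ln|ln|ln] := ltngtP l n.+1; last first.
- rewrite ln ltnn mulr0 add0r mulr1; congr Num.sqrt.
  rewrite /connection_row shifted_GammaS -[n.+1%:R]natr1 e1 e2 e3.
  have -> : n%:R + 1 + a + 1 = n%:R + a + 2 by ring.
  rewrite (GammaS nab) (GammaS nb) (GammaS na) (GammaS n1).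
  by field; rewrite ?g1 ?g2 ?g3 ?g4 ?h1 ?h2 ?h3 ?h4.
- by rewrite leqNgt (ltn_trans _ ln)//= !mulr0 addr0.
rewrite -[(l <= n)%N]ltnS ln mulr0 addr0 -sqrtrM; last first.
  by apply: ltW; apply: divr_gt0; apply: mulr_gt0.
congr Num.sqrt; rewrite -[n.+1%:R]natr1 e1 e2 e3.
rewrite (GammaS nab) (GammaS nb) (GammaS na) (GammaS n1).
by field; rewrite ?g1 ?g2 ?g3 ?g4 ?h1 ?h2 ?h3 ?h4.
Qed.

(** The other output of the same mixing: column n takes its final form, the unit vector supplying
    the subdiagonal entry. *)
Lemma connection_coef_givens n l :
  connection_coef b a l n =
    givens_cos a b n * givens_column n l - givens_sin a b n * (l == n.+1)%:R.
Proof.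
have [nb nab na n1 n3] := factors_gt0 n.
have g1 := Gamma_neq0 nb; have g2 := Gamma_neq0 nab; have g3 := Gamma_neq0 na;
  have g4 := Gamma_neq0 n1.
have h2 := lt0r_neq0 nab; have h3 := lt0r_neq0 na.
have a10 : 0 < a + 1 by move: a1; lra.
rewrite /connection_coef /givens_column; case: leqP => ln; last first.
  by rewrite mulr0 add0r; case: eqP; rewrite ?mulr1 ?mulr0 ?oppr0.
rewrite ltn_eqF ?ltnS// mulr0 subr0 mulr_sqrt ?(ltW a10)// -sqrtrM; last first.
  by apply: ltW; apply: divr_gt0; apply: mulr_gt0.
congr Num.sqrt; rewrite /connection_col.
have -> : n%:R + a + b + 3 = n%:R + a + b + 2 + 1 by ring.
have -> : n%:R + a + 3 = n%:R + a + 2 + 1 by ring.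
rewrite (GammaS nab) (GammaS na).
by field; rewrite ?g1 ?g2 ?g3 ?g4 ?h2 ?h3.
Qed.

(** Invariant of the induction on the number of rotations: columns before [m] are final, column [m]
    is active, and later ones are still those of the identity. *)
Lemma givens_product K m (l j : 'I_K) : (m < K)%N ->
  (\prod_(i < m) (givens a b K i : 'M[R]_K)) l j =
    if (j < m)%N then connection_coef b a l j
    else if j == m :> nat then givens_column m l else (l == j)%:R.
Proof.
elim: m l j => [|m IHm] l j mK.
  rewrite big_ord0 mxE ltn0 givens_column0 -val_eqE/=.
  by have [->|//] := eqVneq (j : nat) 0%N.
have mK' := ltnW mK; pose i0 := Ordinal mK'; pose i1 := Ordinal mK.
rewrite big_ord_recr /= -mulmxE.
rewrite (@mulmx_givens _ _ _ i0 i1)// !IHm// -!val_eqE /= ltnn eqxx.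
rewrite [(m.+1 < m)%N]ltnNge leqnSn [m.+1 == m]gtn_eqF//=.
have [jm|jm] := eqVneq (j : nat) m.
  by rewrite jm ltnSn connection_coef_givens.
have [jm1|jm1] := eqVneq (j : nat) m.+1;
  first by rewrite jm1 ltnn givens_columnS.
by rewrite ltnS [(j <= m)%N]leq_eqVlt (negbTE jm).
Qed.

End givens_product.

Theorem theorem5p3 (R : realType) (alpha beta : R)
    (halpha : -1 < alpha) (hbeta : -1 < beta) :
  let p := fun n : nat => (1 - 'X) * orthonormal_jacobi (alpha + 2) beta n in
  let q := orthonormal_jacobi alpha beta in
  (exists c : nat -> nat -> R, connection_coefficients p q c) /\
  (forall c : nat -> nat -> R, connection_coefficients p q c ->
    (forall l n : nat,
      c l n =
        if (l <= n)%N then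
          (alpha + 1) *
          Num.sqrt
            ((shifted_Gamma alpha beta l * Gamma (l%:R + alpha + 1) /
              (Gamma (l%:R + beta + 1) * Gamma (l%:R + 1))) *
             ((2 * n%:R + alpha + beta + 3) * Gamma (n%:R + beta + 1)
                * Gamma (n%:R + 1) /
              (Gamma (n%:R + alpha + beta + 3) * Gamma (n%:R + alpha + 3))))
        else if l == n.+1 then
          - Num.sqrt ((n%:R + 1) * (n%:R + beta + 1) /
                      ((n%:R + alpha + 2) * (n%:R + alpha + beta + 2)))
        else 0) /\
    (forall N : nat,
      \matrix_(l < N.+2, n < N.+1) c l n =
        (\prod_(i < N.+1) givens alpha beta N.+2 i) *m pid_mx N.+1)).
Proof.
move=> p q; split.
  by exists (connection_coef beta alpha); apply/connection_coefficientsP.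
move=> c /(connection_coefficientsP hbeta halpha) cE; split=> [l n|N];
  first exact: cE.
apply/matrixP => l n; rewrite !mxE cE.
have nN : (n < N.+2)%N := ltnW (ltn_ord n).
(* Multiplication by [pid_mx] discards the active column N+1, so only final columns remain. *)
rewrite (bigD1 (Ordinal nN))//= givens_product//= ltn_ord mxE /=
  eqxx ltn_ord mulr1.
rewrite big1 ?addr0// => k; rewrite -val_eqE /= => kn.
by rewrite mxE (negbTE kn) mulr0.
Qed.
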